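(* Let $p\in(0,1)$ and $-1<\beta<p/(1-p)$. Let $\Xi_n$ be the position at time $n$ of the laziest elephant random walk with power law memory with parameters $(p,\beta)$, and let $M_\infty$ be the almost sure limit of the associated non-negative martingale $(M_n)_{n\in\mathbb{N}}$. Then $P(M_\infty>0)>0$, and, almost surely on the event $\{M_\infty>0\}$, $$\Xi_n\sim C(p,\beta)\,M_\infty\, n^{p(\beta+1)-\beta}\quad\text{as } n\to\infty,$$ where $$C(p,\beta):=\frac{1}{p(\beta+1)-\beta}\cdot\frac{\Gamma(\beta+1)}{\Gamma(p(\beta+1))}.$$
   Context: For $\xi>-1$ and $n\in\mathbb{N}=\{1,2,\dots\}$ put $c_n(\xi):=\dfrac{\Gamma(n+\xi)}{\Gamma(n)\Gamma(\xi+1)}$, and $\mu_n:=c_n(\beta)$. Laziest elephant random walk with power law memory, with parameters $p\in(0,1)$, $\beta>-1$: let $\{\beta_{n+1}:n\in\mathbb{N}\}$ be independent random variables with $$P(\beta_{n+1}=k)=\frac{\beta+1}{n}\cdot\frac{\mu_k}{\mu_{n+1}}\quad (1\le k\le n),$$ and $P(\beta_{n+1}=k)=0$ otherwise (this is a probability mass function). Set $X_1\equiv 1$ and, for $n\ge 1$, $X_{n+1}=X_{\beta_{n+1}}$ with probability $p$ and $X_{n+1}=0$ with probability $1-p$; that is, $X_{n+1}=\alpha_{n+1}X_{\beta_{n+1}}$, where the $\alpha_{n+1}$ are i.i.d. Bernoulli($p$) random variables independent of $\{\beta_{n+1}\}$. The walk is $\Xi_0=0$, $\Xi_n=\sum_{k=1}^n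 X_k$. Put $\Sigma_n:=\sum_{k=1}^n X_k\mu_k$ and $M_n:=\Sigma_n/c_n(p(\beta+1))$. With $\mathcal{F}_n=\sigma(X_1,\dots,X_n)$, $(M_n)$ is a non-negative $(\mathcal{F}_n)$-martingale, so it has an almost sure limit $M_\infty:=\lim_{n\to\infty}M_n\ge 0$. Here $a_n\sim b_n$ means $a_n/b_n\to1$. *)

(* Defs.v *)
From mathcomp Require Import all_boot all_order all_algebra.
From mathcomp Require Import all_classical all_reals all_analysis.

Set Implicit Arguments.
Unset Strict Implicit.
Unset Printing Implicit Defensive.

Import Order.TTheory GRing.Theory Num.Theory.
Import numFieldNormedType.Exports.

Local Open Scope classical_set_scope.
Local Open Scope ring_scope.

(* Euler's integral; the real-valued integral is meaningful for [0 < x], the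
   only case used below. *)
Definition Gamma (R : realType) (x : R) : R :=
  \int[@lebesgue_measure R]_(t in `]0, +oo[) (t `^ (x - 1) * expR (- t)).

Section independence.
Context d (T : measurableType d) (R : realType) (P : probability T R).

Definition mutually_independent d' (T' : measurableType d')
    (D : set nat) (Y : nat -> T -> T') : Prop :=
  forall (J : seq nat) (A : nat -> set T'),
    uniq J -> (forall n, n \in J -> D n) ->
    (forall n, n \in J -> measurable (A n)) ->
    P (\bigcap_(n in [set` J]) (Y n @^-1` A n)) =
    (\prod_(n <- J) P (Y n @^-1` A n))%E.

Definition sigma_generated d' (T' : measurableType d')
    (D : set nat) (Y : nat -> T -> T') : set (set T) :=
  <<s \bigcup_(n in D) preimage_set_system setT (Y n) measurable >>.

Definition independent_systems (F G : set (set T)) : Prop :=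
  forall A B, F A -> G B -> P (A `&` B) = (P A * P B)%E.

End independence.

Section laziest_elephant.
Context (R : realType).

(* Sequences are indexed by [n = 1, 2, ...]; values at [0] are irrelevant. *)
Definition cseq (n : nat) (xi : R) : R :=
  Gamma (n%:R + xi) / (Gamma n%:R * Gamma (xi + 1)).

Definition mu_ (beta : R) (n : nat) : R := cseq n beta.

Context d (T : measurableType d) (P : probability T R).

(* [recall n.+1] is the remembered time (written beta_(n+1) in the literature,
   not to be confused with the parameter [beta]), and [alpha n.+1] the
   Bernoulli variable telling whether the remembered step is repeated. *)
Record laziest_erw (p beta : R) (alpha : nat -> {RV P >-> bool})
    (recall : nat -> {RV P >-> nat}) (X : nat -> {RV P >-> R}) : Prop := {
  recall_pmf : forall n k, (1 <= n)%N -> (1 <= k <= n)%N ->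
    P (recall n.+1 @^-1` [set k]) =
    ((beta + 1) / n%:R * (mu_ beta k / mu_ beta n.+1))%:E ;
  recall_pmf0 : forall n k, (1 <= n)%N -> ~~ (1 <= k <= n)%N ->
    P (recall n.+1 @^-1` [set k]) = 0%E ;
  recall_indep : mutually_independent P [set n | (2 <= n)%N] recall ;
  alpha_bernoulli : forall n, (1 <= n)%N ->
    distribution P (alpha n.+1) = bernoulli_prob p :> (set bool -> \bar R) ;
  alpha_indep : mutually_independent P [set n | (2 <= n)%N] alpha ;
  alpha_recall_indep : independent_systems P
    (sigma_generated [set n | (2 <= n)%N] alpha)
    (sigma_generated [set n | (2 <= n)%N] recall) ;
  step1 : forall w, X 1%N w = 1 ;
  (* almost surely, because [recall n.+1] lies in [1, n] only almost surely *)
  stepS : forall n, (1 <= n)%N ->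
    {ae P, forall w, X n.+1 w = (alpha n.+1 w)%:R * X (recall n.+1 w) w} }.

Definition walk (X : nat -> T -> R) (n : nat) (w : T) : R :=
  \sum_(1 <= k < n.+1) X k w.

Definition Sigma_ (beta : R) (X : nat -> T -> R) (n : nat) (w : T) : R :=
  \sum_(1 <= k < n.+1) X k w * mu_ beta k.

Definition M_ (p beta : R) (X : nat -> T -> R) (n : nat) (w : T) : R :=
  Sigma_ beta X n w / cseq n (p * (beta + 1)).

Definition as_limit (Y : nat -> T -> R) (Z : T -> R) : Prop :=
  {ae P, forall w, Y n w @[n --> \oo] --> Z w}.

Definition asymp_equiv (a b : nat -> R) : Prop :=
  a n / b n @[n --> \oo] --> (1 : R).

Definition Cconst (p beta : R) : R :=
  1 / (p * (beta + 1) - beta) * (Gamma (beta + 1) / Gamma (p * (beta + 1))).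

End laziest_elephant.

(* Main.v *)
Require Import Defs.
From mathcomp Require Import all_boot all_order all_algebra.
From mathcomp Require Import all_classical all_reals all_analysis.
From mathcomp Require Import measurable_realfun.
From mathcomp Require Import ring lra.
Import Order.TTheory GRing.Theory Num.Theory.
Import numFieldNormedType.Exports.
Local Open Scope classical_set_scope.
Local Open Scope ring_scope.

(** Write [g = p * (beta + 1)] and [M_ n = Sigma_ n / cseq n g].  Given the past,
    step [n.+1] has conditional mean [gain n * Sigma_ n], because the law of the
    recalled time is proportional to the weights in [Sigma_].  Hence [M_] has mean 1,
    and the compensator of the walk is

      [K * \sum_(k < n) (growth k.+1 - growth k) * M_ k],  [K = g / (g - beta)],

    where [growth n = cseq n g / mu_ beta n] increases to infinity because
    [beta < g].  It is therefore a weighted mean of the values of the martingale, and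
    it is equivalent to [K * Minf * growth n] ([cvg_weighted_mean]).

    The walk minus its compensator has orthogonal increments and second moment at
    most a multiple of [growth n].  Along the times [j.+1 ^ q], with [q] so large that
    [growth (j.+1 ^ q)] dominates [j ^ 2], the squares of the quotients by [growth]
    have summable means, so the quotients tend to 0 almost surely.  The ratio of
    [growth] at consecutive such times tends to 1 and the walk is nondecreasing, so
    the convergence extends to all times ([cvg_of_compensator]).  Finally [growth n]
    is equivalent to [Gamma (beta + 1) / Gamma (g + 1) * n `^ (g - beta)], by the
    log-convexity bounds for the Gamma function ([cvg_Gamma_ratio]).

    For the positivity of [Minf], the second moment of [M_] stays bounded
    ([mean_Sigma_sqr_le]), again because [beta < g].  By a Paley--Zygmund estimate
    [M_ n > 1/2] has probability bounded below, which is incompatible with an almost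
    surely vanishing limit ([prob_limit_gt0]).

    Expectations are computed for a version [step] of the steps that satisfies the
    defining recursion everywhere.  Independence enters through the fact that
    products of two past steps are uncorrelated with future recall events
    ([past_future_indep]): the quantities above are linear in the steps, so their
    second moments involve pairs of steps only. *)

Set Implicit Arguments.
Unset Strict Implicit.
Unset Printing Implicit Defensive.

(** * The Gamma function *)

Section gamma.
Context {R : realType}.
Notation mu := (@lebesgue_measure R).
Implicit Types x a t : R.

Definition gamma_kernel x t : R := t `^ (x - 1) * expR (- t).

(** Extended-real Euler integral.  Its functional equation holds before
    integrability is known, and finiteness is then deduced from it. *)
Definition egamma x : \bar R :=
  (\int[mu]_(t in `]0%R, +oo[) (gamma_kernel x t)%:E)%E.

Lemma gamma_kernel_ge0 x t : 0 <= gamma_kernel x t.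
Proof. by rewrite mulr_ge0 ?powR_ge0 ?expR_ge0. Qed.

Lemma measurable_gamma_kernel (D : set R) x :
  measurable_fun D (EFin \o gamma_kernel x).
Proof.
apply: measurable_funTS; apply/measurable_EFinP; apply: measurable_funM.
  exact: measurable_powR.
apply: measurableT_comp; first exact: measurable_expR.
exact: measurable_funN.
Qed.

Lemma egamma_ge0 x : (0 <= egamma x)%E.
Proof. by apply: integral_ge0 => t _; rewrite lee_fin gamma_kernel_ge0. Qed.

Lemma GammaE x : Gamma x = fine (egamma x).
Proof. by []. Qed.

(** A compact exhaustion of the half-line on which the kernel is regular. *)
Let I (k : nat) : set R := `[(k.+1%:R)^-1, k.+2%:R].

Let bigcup_I : \bigcup_k I k = `]0%R, +oo[%classic.
Proof.
apply/seteqP; split => t /=.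
  move=> [k _]; rewrite /I /= !in_itv /= andbT => /andP[kt _].
  by apply: lt_le_trans kt; rewrite invr_gt0.
rewrite in_itv/= andbT => t0.
exists (maxn (Num.truncn (t^-1)) (Num.truncn t)) => //.
rewrite /I /= in_itv /=; apply/andP; split.
  rewrite -[leRHS]invrK lef_pV2 ?posrE ?invr_gt0//.
  apply/ltW/(lt_le_trans (truncnS_gt _)).
  by rewrite ler_nat ltnS leq_maxl.
apply/ltW/(lt_le_trans (truncnS_gt _)).
rewrite ler_nat; apply: leq_trans (leqnSn _).
by rewrite ltnS leq_maxr.
Qed.

Lemma cvg_egamma x :
  (\int[mu]_(t in I k) (gamma_kernel x t)%:E)%E @[k --> \oo] --> egamma x.
Proof.
rewrite /egamma -bigcup_I; apply: ge0_nondecreasing_set_cvg_integral.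
- move=> m n mn; rewrite subsetEset => t; rewrite /I/= !in_itv/= => /andP[mt tm].
  apply/andP; split.
    by apply: le_trans mt; rewrite lef_pV2 ?posrE// ler_nat ltnS.
  by apply: (le_trans tm); rewrite ler_nat !ltnS.
- by move=> k; exact: measurable_itv.
- by move=> k; exact: measurable_gamma_kernel.
- by move=> k t _; rewrite lee_fin gamma_kernel_ge0.
Qed.

Lemma continuous_powR_gt0 a t : 0 < t -> {for t, continuous (@powR R ^~ a)}.
Proof.
move=> t0; apply: differentiable_continuous; apply/derivable1_diffP.
by apply: derivable_powR; rewrite in_itv/= andbT.
Qed.

Let continuous_expRN : continuous (fun t : R => expR (- t)).
Proof.
move=> t; apply: (@continuous_comp _ _ _ (fun t : R => - t) expR).
  exact: opp_continuous.
exact: continuous_expR.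
Qed.

Let derive_expRN t : is_derive t 1 (fun t : R => - expR (- t)) (expR (- t)).
Proof.
have h : is_derive t 1 (expR \o -%R) (expR (- t) * -1).
  exact: is_derive1_comp.
have -> : expR (- t) = - (expR (- t) * -1) by rewrite mulrN1 opprK.
exact: is_deriveN.
Qed.

(** The boundary terms of the integration by parts on [I k]. *)
Let boundary x (k : nat) : R :=
  (k.+1%:R)^-1 `^ x * expR (- (k.+1%:R)^-1) - k.+2%:R `^ x * expR (- k.+2%:R).

Lemma gamma_parts x (k : nat) :
  (\int[mu]_(t in I k) (gamma_kernel (x + 1) t)%:E =
   (boundary x k)%:E + x%:E * \int[mu]_(t in I k) (gamma_kernel x t)%:E)%E.
Proof.
have k0 : 0 < (k.+1%:R)^-1 :> R by rewrite invr_gt0.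
have Ipos t : t \in I k -> 0 < t.
  by rewrite /I inE /= in_itv/= => /andP[+ _]; exact: lt_le_trans.
have ab : (k.+1%:R)^-1 < k.+2%:R :> R.
  by apply: (@le_lt_trans _ _ 1); rewrite ?invf_le1 ?ler1n// ltr1n.
have cP a : {within I k, continuous (@powR R ^~ a)}.
  apply/continuous_in_subspaceT => t tI; apply: continuous_powR_gt0.
  exact: Ipos.
have := @integration_by_parts R (@powR R ^~ x) (fun t => - expR (- t))
   (fun t => x * t `^ (x - 1)) (fun t => expR (- t)) _ _ ab.
have Ho t : t \in `](k.+1%:R)^-1, k.+2%:R[ -> 0 < t.
  by rewrite in_itv/= => /andP[+ _]; exact: lt_trans.
rewrite {1}/gamma_kernel addrK /I => ->.
- have iK : mu.-integrable (I k) (EFin \o gamma_kernel x).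
    apply: continuous_compact_integrable; first exact: segment_compact.
    apply/continuous_in_subspaceT => t tI; apply: cvgM.
      by apply: continuous_powR_gt0; exact: Ipos.
    exact: continuous_expRN.
  have -> : (\int[mu]_(t in I k) (x * t `^ (x - 1) * - expR (- t))%:E =
      (- x)%:E * \int[mu]_(t in I k) (gamma_kernel x t)%:E)%E.
    rewrite -(integralZl _ iK); last exact: measurable_itv.
    by apply: eq_integral => t _ /=;
       rewrite -EFinM; congr (_%:E); rewrite /gamma_kernel; ring.
  rewrite EFinN mulNe oppeK; congr (_ + _)%E.
  by rewrite /boundary; congr (_%:E); ring.
- apply/continuous_in_subspaceT => t tI; apply: cvgM; first exact: cvg_cst.
  by apply: continuous_powR_gt0; exact: Ipos.
- split => [t /Ho t0||].
  + by apply: derivable_powR; rewrite in_itv/= andbT.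
  + by apply: cvg_at_right_filter; exact: continuous_powR_gt0.
  + by apply: cvg_at_left_filter; exact: continuous_powR_gt0.
- by move=> t /Ho t0; apply: powR_derive1; rewrite in_itv/= andbT.
- by apply/continuous_in_subspaceT => t _; exact: continuous_expRN.
- split => [t _||].
  + by have [] := derive_expRN t.
  + by apply: cvg_at_right_filter; apply: cvgN; exact: continuous_expRN.
  + by apply: cvg_at_left_filter; apply: cvgN; exact: continuous_expRN.
- by move=> t _; rewrite derive1E; have [_ ->] := derive_expRN t.
Qed.

(** At infinity, [k ^ x * exp (- k) <= (m + 1)! / k] for any integer [m >= x]. *)
Let cvg_boundary x : 0 < x -> boundary x k @[k --> \oo] --> 0.
Proof.
move=> x0; rewrite /boundary -[X in _ --> X]subr0; apply: cvgB.
  apply: (@squeeze_cvgr _ _ _ _ (cst 0) (fun k => (k.+1%:R : R)^-1 `^ x)).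
  - apply: nearW => k; rewrite mulr_ge0 ?powR_ge0 ?expR_ge0//=.
    by rewrite ler_piMr ?powR_ge0// expR_le1 oppr_le0 invr_ge0.
  - exact: cvg_cst.
  - have /cvg_at_rightP := powR_cvg0 x0; apply; split=> [n|].
      by rewrite invr_gt0.
    exact: cvg_harmonic.
have xm : x <= (Num.truncn x).+1%:R by exact/ltW/truncnS_gt.
set m := (Num.truncn x).+1 in xm.
apply: (@squeeze_cvgr _ _ _ _ (cst 0) (fun k => m.+1`!%:R * (k.+1%:R : R)^-1)).
- apply: nearW => k; rewrite mulr_ge0 ?powR_ge0 ?expR_ge0//=.
  have k2 : 1 <= k.+2%:R :> R by rewrite ler1n.
  rewrite expRN ler_pdivrMr ?expR_gt0//.
  apply: (@le_trans _ _ (k.+2%:R ^+ m)).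
    by rewrite -powR_mulrn//; exact: ler_powR.
  apply: (@le_trans _ _ (m.+1`!%:R / k.+1%:R * (k.+2%:R ^+ m.+1 / m.+1`!%:R))).
    rewrite [leRHS](_ : _ = k.+2%:R ^+ m * (k.+2%:R / k.+1%:R)).
      rewrite ler_peMr ?exprn_ge0// ler_pdivlMr// mul1r ler_nat//.
    have f0 : m.+1`!%:R != 0 :> R by rewrite pnatr_eq0 -lt0n fact_gt0.
    have k0 : k.+1%:R != 0 :> R by rewrite pnatr_eq0.
    move: f0 k0; rewrite exprSr.
    move: (m.+1`!%:R : R) (k.+1%:R : R) (k.+2%:R : R) => f a b f0 a0.
    by field; rewrite f0 a0.
  apply: ler_wpM2l; first by rewrite divr_ge0.
  apply: le_trans (expR_ge1Dxn m (ler0n _ _)).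
  by rewrite lerDr.
- exact: cvg_cst.
- rewrite -[X in _ --> X](mulr0 (m.+1`!%:R)); apply: cvgM; first exact: cvg_cst.
  exact: cvg_harmonic.
Qed.

Lemma egammaS x : 0 < x -> egamma (x + 1) = (x%:E * egamma x)%E.
Proof.
move=> x0; rewrite -(cvg_lim _ (@cvg_egamma (x + 1)))//; apply/cvg_lim => //.
under eq_fun do rewrite gamma_parts.
rewrite -[(x%:E * egamma x)%E]add0e; apply: cvgeD => //.
- by apply/cvg_EFin; [exact: nearW|exact: cvg_boundary].
- by apply: cvgeZl => //; exact: cvg_egamma.
Qed.

Lemma egamma1 : egamma 1 = 1%E.
Proof.
rewrite /egamma integral_itv_obnd_cbnd; last first.
  exact: measurable_gamma_kernel.
under eq_integral do rewrite /gamma_kernel subrr powRr0 mul1r.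
rewrite (@ge0_continuous_FTC2y _ _ (fun t => - expR (- t)) 0 0).
- by rewrite oppr0 expR0 sub0e -EFinN opprK.
- by move=> t _; exact: expR_ge0.
- by apply/continuous_in_subspaceT => t _; exact: continuous_expRN.
- by rewrite -oppr0; apply: cvgN; exact: cvgr_expR.
- by move=> t _; have [] := derive_expRN t.
- by apply: cvg_at_right_filter; apply: cvgN; exact: continuous_expRN.
- by move=> t _; rewrite derive1E; have [_ ->] := derive_expRN t.
Qed.

Lemma egamma_nat_lty (n : nat) : (egamma n.+1%:R < +oo)%E.
Proof.
elim: n => [|n IH]; first by rewrite egamma1 ltry.
by rewrite -natr1 egammaS// lte_mul_pinfty.
Qed.

(** For [x >= 1] the kernel is bounded by the sum of the kernels of [1] and of an
    integer above [x]; the functional equation brings [0 < x < 1] to this case. *)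
Lemma egamma_lty x : 0 < x -> (egamma x < +oo)%E.
Proof.
have big y : 1 <= y -> (egamma y < +oo)%E.
  move=> y1; set m := (Num.truncn y).
  have ym : y <= m.+1%:R by exact/ltW/truncnS_gt.
  apply: (@le_lt_trans _ _ (egamma 1 + egamma m.+1%:R)%E); last first.
    by apply: lte_add_pinfty; [rewrite egamma1 ltry|exact: egamma_nat_lty].
  rewrite /egamma -ge0_integralD//=; last 4 first.
  - by move=> t _; rewrite lee_fin gamma_kernel_ge0.
  - exact: measurable_gamma_kernel.
  - by move=> t _; rewrite lee_fin gamma_kernel_ge0.
  - exact: measurable_gamma_kernel.
  apply: ge0_le_integral => //=.
  - by move=> t _; rewrite lee_fin gamma_kernel_ge0.
  - exact: measurable_gamma_kernel.
  - exact: (emeasurable_funD (@measurable_gamma_kernel _ 1)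
                             (@measurable_gamma_kernel _ m.+1%:R)).
  move=> t /=; rewrite in_itv/= andbT => t0; rewrite -EFinD lee_fin.
  rewrite /gamma_kernel -mulrDl ler_wpM2r ?expR_ge0// subrr powRr0.
  have [t1|t1] := leP t 1.
    apply: (@le_trans _ _ 1); last by rewrite lerDl powR_ge0.
    rewrite -[leRHS](powRr0 t).
    by apply: ger_powR; rewrite ?t0 ?t1// subr_ge0.
  apply: (@le_trans _ _ (t `^ (m.+1%:R - 1))); last by rewrite lerDr.
  by apply: ler_powR; [exact: ltW|rewrite lerB].
move=> x0; rewrite ltey; apply/negP => /eqP xoo.
have := big (x + 1); rewrite lerDr ltW// egammaS// xoo gt0_muley ?lte_fin//.
by rewrite ltxx => /(_ isT).
Qed.

Lemma egamma_fin_num x : 0 < x -> egamma x \is a fin_num.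
Proof. by move=> x0; rewrite ge0_fin_numE ?egamma_ge0// egamma_lty. Qed.

Lemma GammaS x : 0 < x -> Gamma (x + 1) = x * Gamma x.
Proof. by move=> x0; rewrite !GammaE egammaS// fineM// egamma_fin_num. Qed.

Lemma Gamma1 : Gamma 1 = 1 :> R.
Proof. by rewrite GammaE egamma1. Qed.

(** The concave [t `^ a] lies below its tangent at [t = 1]. *)
Lemma powR_le_tangent a t : 0 <= a <= 1 -> 0 <= t -> t `^ a <= (1 - a) + a * t.
Proof.
move=> /andP[a0 a1] t0.
have [->|an0] := eqVneq a 0; first by rewrite powRr0 subr0 mul0r addr0.
have [->|an1] := eqVneq a 1; first by rewrite powRr1// subrr mul1r add0r.
have {an0}a_gt0 : 0 < a by rewrite lt_neqAle eq_sym an0.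
have {an1}a_lt1 : 0 < 1 - a by rewrite subr_gt0 lt_neqAle an1.
have := @conjugate_powR R (t `^ a) 1 a^-1 (1 - a)^-1.
rewrite !invr_gt0 !invrK mulr1 powR1 mul1r -powRrM mulfV ?gt_eqF// powRr1//.
move=> h; rewrite addrC [a * t]mulrC; apply: h => //; first exact: powR_ge0.
by rewrite addrC subrK.
Qed.

Let gamma_kernelD_le x a t : 0 < x -> 0 <= a <= 1 -> 0 < t ->
  gamma_kernel (x + a) t <= (1 - a) * x `^ a * gamma_kernel x t +
                            a * x `^ a / x * gamma_kernel (x + 1) t.
Proof.
move=> x0 a01 t0; rewrite /gamma_kernel !mulrA -mulrDl ler_wpM2r ?expR_ge0//.
have -> : t `^ (x + a - 1) = t `^ (x - 1) * t `^ a.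
  by rewrite addrAC (@powRD _ t (x - 1) a)//; apply/implyP => _; rewrite gt_eqF.
have -> : t `^ (x + 1 - 1) = t `^ (x - 1) * t.
  by rewrite addrK mulrC mulr_powRB1// ltW.
rewrite [leRHS](_ : _ = t `^ (x - 1) * (x `^ a * ((1 - a) + a * (t / x))));
  last by field; rewrite gt_eqF.
rewrite ler_wpM2l ?powR_ge0//.
rewrite [in leLHS](_ : t = x * (t / x)); last by field; rewrite gt_eqF.
rewrite powRM ?divr_ge0 ?(ltW x0) ?(ltW t0)//.
rewrite ler_wpM2l ?powR_ge0//; apply: powR_le_tangent => //.
by rewrite divr_ge0// ltW.
Qed.

(** Half of log-convexity, obtained by integrating the tangent-line bound of
    [t `^ a] at [t = x] against the kernel. *)
Lemma GammaD_le x a : 0 < x -> 0 <= a <= 1 -> Gamma (x + a) <= x `^ a * Gamma x.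
Proof.
move=> x0 a01; have /andP[a0 a1] := a01.
rewrite !GammaE -lee_fin EFinM !fineK ?egamma_fin_num//; last first.
  by rewrite ltr_wpDr.
have -> : ((x `^ a)%:E * egamma x =
    ((1 - a) * x `^ a)%:E * egamma x + (a * x `^ a / x)%:E * egamma (x + 1))%E.
  rewrite egammaS// muleA -EFinM -muleDl ?egamma_fin_num// -EFinD.
    by congr (_%:E * _)%E; field; rewrite gt_eqF.
have p1 : 0 <= (1 - a) * x `^ a by rewrite mulr_ge0 ?powR_ge0 ?subr_ge0.
have p2 : 0 <= a * x `^ a / x by rewrite divr_ge0 ?mulr_ge0 ?powR_ge0// ltW.
have mk (c y : R) (D : set R) : measurable_fun D
    (fun t => c%:E * (gamma_kernel y t)%:E)%E.
  by apply: measurable_funeM; exact: measurable_gamma_kernel.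
have K0 y t : (0%R <= (gamma_kernel y t)%:E)%E.
  by rewrite lee_fin gamma_kernel_ge0.
rewrite /egamma -!ge0_integralZl ?lee_fin//; [|exact: measurable_gamma_kernel..].
have cK0 (c y t : R) : 0 <= c -> (0%R <= c%:E * (gamma_kernel y t)%:E)%E.
  by move=> c0; rewrite mule_ge0 ?lee_fin ?gamma_kernel_ge0.
rewrite -ge0_integralD//;
  [|by move=> t _; exact: cK0|exact: mk|by move=> t _; exact: cK0|exact: mk].
apply: ge0_le_integral => //.
- exact: measurable_gamma_kernel.
- by apply: emeasurable_funD; exact: mk.
move=> t /=; rewrite in_itv/= andbT => t0; rewrite -!EFinM -EFinD lee_fin.
exact: gamma_kernelD_le.
Qed.

(** [GammaD_le] bounds a Gamma value at an integer, which is positive, by a multiple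
    of [Gamma x]. *)
Lemma Gamma_gt0 x : 0 < x -> 0 < Gamma x.
Proof.
have natG (n : nat) : 0 < Gamma n.+1%:R :> R.
  by elim: n => [|n IH]; [rewrite Gamma1|rewrite -natr1 GammaS// mulr_gt0].
move=> x0; set n := Num.truncn x.
have xn : x < n.+1%:R by exact: truncnS_gt.
have := natG n; rewrite (_ : n.+1%:R = x + (n.+1%:R - x)); last first.
  by rewrite addrC subrK.
move=> /lt_le_trans/(_ (GammaD_le x0 _)).
rewrite subr_ge0 (ltW xn) /= lerBlDl -natr1 lerD2r.
have -> : n%:R <= x by rewrite /n truncn_le ltW.
by move=> /(_ isT); rewrite pmulr_rgt0// powR_gt0.
Qed.

(** The reverse inequality, from [GammaD_le] applied between [x + a] and [x + 1]. *)
Lemma GammaD_ge x a : 0 < x -> 0 <= a <= 1 ->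
  x `^ a * (x / (x + a)) <= Gamma (x + a) / Gamma x.
Proof.
move=> x0 /andP[a0 a1].
have xa0 : 0 < x + a by rewrite ltr_wpDr.
have := @GammaD_le (x + a) (1 - a) xa0.
rewrite subr_ge0 a1 lerBlDr lerDl a0 => /(_ isT).
rewrite -addrA [a + _]addrC subrK GammaS// => h.
rewrite ler_pdivlMr ?Gamma_gt0//.
rewrite -(ler_pM2l (powR_gt0 (1 - a) xa0)).
apply: le_trans h; rewrite !mulrA ler_wpM2r ?(ltW (Gamma_gt0 x0))//.
rewrite powRB; last by apply/implyP => _; rewrite gt_eqF.
rewrite powRr1 ?(ltW xa0)//.
rewrite [leLHS](_ : _ = x * (x `^ a / (x + a) `^ a)); last first.
  by field; rewrite gt_eqF ?powR_gt0// gt_eqF.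
rewrite ler_piMr ?(ltW x0)// ler_pdivrMr ?powR_gt0// mul1r.
by apply: ge0_ler_powR; rewrite ?nnegrE ?lerDl// ltW.
Qed.

Lemma cvg_natD_div (c : R) : (n%:R + c) / n%:R @[n --> \oo] --> (1 : R).
Proof.
have h : 1 + c * n%:R^-1 @[n --> \oo] --> (1 : R).
  rewrite -[X in _ --> X]addr0; apply: cvgD; first exact: cvg_cst.
  rewrite -(mulr0 c); apply: cvgM; first exact: cvg_cst.
  by rewrite -cvg_shiftS; exact: cvg_harmonic.
apply: cvg_trans h; apply: near_eq_cvg; near=> n.
have n0 : n%:R != 0 :> R by rewrite pnatr_eq0 -lt0n; near: n; exact: nbhs_infty_gt.
by rewrite mulrDl mulfV.
Unshelve. all: by end_near. Qed.

(** The sandwich squeezes the ratio of Gamma values at distance [a], because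
    [((n + b) / n) `^ a] and [(n + b) / (n + b + a)] both tend to 1. *)
Lemma cvg_Gamma_ratio (b a : R) : -1 < b -> 0 <= a <= 1 ->
  Gamma (n%:R + (b + a)) / Gamma (n%:R + b) / n%:R `^ a @[n --> \oo] --> (1 : R).
Proof.
move=> b1 a01; have /andP[a0 a1] := a01.
have powcvg : ((n%:R + b) / n%:R) `^ a @[n --> \oo] --> (1 : R).
  have := @continuous_cvg nat R R \oo _ (fun n => (n%:R + b) / n%:R)
    (@powR R ^~ a) 1 (continuous_powR_gt0 ltr01) (cvg_natD_div b).
  by rewrite powR1; apply.
have fracvg : (n%:R + b) / (n%:R + b + a) @[n --> \oo] --> (1 : R).
  have h : ((n%:R + b) / n%:R) / ((n%:R + (b + a)) / n%:R) @[n --> \oo] --> (1 : R).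
    rewrite -[X in _ --> X](divr1 1); apply: cvgM; first exact: cvg_natD_div.
    by apply: cvgV; [exact: oner_neq0|exact: cvg_natD_div].
  apply: cvg_trans h; apply: near_eq_cvg; near=> n.
  have n0 : (0 < n)%N by near: n; exact: nbhs_infty_gt.
  have nR : 1 <= n%:R :> R by rewrite ler1n.
  have ba0 : n%:R + b + a != 0 by rewrite gt_eqF//; lra.
  by rewrite addrA; field; rewrite ba0 pnatr_eq0 -lt0n.
apply: (@squeeze_cvgr _ _ _ _
  (fun n => ((n%:R + b) / n%:R) `^ a * ((n%:R + b) / (n%:R + b + a)))
  (fun n => ((n%:R + b) / n%:R) `^ a)); last 2 first.
- by rewrite -[X in _ --> X]mulr1; exact: cvgM.
- exact: powcvg.
near=> n.
have n0 : (0 < n)%N by near: n; exact: nbhs_infty_gt.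
have nR : 1 <= n%:R :> R by rewrite ler1n.
have nb0 : 0 < n%:R + b by lra.
have nR0 : 0 < n%:R :> R by rewrite ltr0n.
rewrite powRM ?invr_ge0 ?(ltW nb0)// addrA.
have -> : (n%:R^-1 : R) `^ a = (n%:R `^ a)^-1 by rewrite -powR_inv1// powRAC powR_inv1 ?powR_ge0.
apply/andP; split.
  rewrite mulrAC ler_wpM2r ?invr_ge0 ?powR_ge0//; exact: GammaD_ge.
rewrite ler_wpM2r ?invr_ge0 ?powR_ge0// ler_pdivrMr ?Gamma_gt0//.
exact: GammaD_le.
Unshelve. all: by end_near. Qed.

End gamma.

(** * The normalizing sequences *)

Local Opaque Gamma.

Section cseq_recurrence.
Context {R : realType}.
Implicit Types xi b g : R.

Lemma cseq1 xi : -1 < xi -> cseq 1 xi = 1.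
Proof.
move=> h; rewrite /cseq Gamma1 mul1r addrC mulfV// gt_eqF// Gamma_gt0//; lra.
Qed.

Lemma cseq_gt0 (n : nat) xi : (0 < n)%N -> -1 < xi -> 0 < cseq n xi.
Proof.
move=> n0 h; have nR : 1 <= n%:R :> R by rewrite ler1n.
by rewrite divr_gt0 ?mulr_gt0 ?Gamma_gt0//; lra.
Qed.

Lemma cseqS (n : nat) xi : (0 < n)%N -> -1 < xi ->
  cseq n.+1 xi = cseq n xi * ((n%:R + xi) / n%:R).
Proof.
move=> n0 h; have nR : 1 <= n%:R :> R by rewrite ler1n.
have n1 : n%:R != 0 :> R by rewrite pnatr_eq0 -lt0n.
rewrite /cseq -natr1 addrAC (@GammaS _ n%:R) ?(@GammaS _ (n%:R + xi)); [|lra..].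
by rewrite [RHS]mulrC mulf_div !mulrA.
Qed.

Let ratio_rearrange (F : fieldType) (u v w x y z : F) : w != 0 ->
  x / y * (u / v / z) = u / (w * y) / (v / (w * x)) / z.
Proof.
move=> w0; rewrite mulrA; congr (_ / _); rewrite (invf_div v) !mulf_div.
by rewrite mulrCA -(mulrA w y) -[RHS]mulf_div divff// mul1r (mulrC x).
Qed.

(** The factors [Gamma n] cancel in the quotient, which leaves a ratio of Gamma
    values at distance [g - b]. *)
Lemma cvg_growth b g : -1 < b -> b <= g <= b + 1 ->
  cseq n g / cseq n b / n%:R `^ (g - b) @[n --> \oo]
    --> Gamma (b + 1) / Gamma (g + 1).
Proof.
move=> b1 /andP[bg gb].
have h : Gamma (b + 1) / Gamma (g + 1) *
    (Gamma (n%:R + (b + (g - b))) / Gamma (n%:R + b) / n%:R `^ (g - b))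
    @[n --> \oo] --> Gamma (b + 1) / Gamma (g + 1).
  rewrite -[X in _ --> X]mulr1; apply: cvgM; first exact: cvg_cst.
  by apply: cvg_Gamma_ratio => //; rewrite subr_ge0 bg/= lerBlDl.
apply: cvg_trans h; apply: near_eq_cvg; near=> n.
have n0 : (0 < n)%N by near: n; exact: nbhs_infty_gt.
have nR : 1 <= n%:R :> R by rewrite ler1n.
rewrite subrKC /cseq.
have g1 : Gamma (n%:R : R) != 0 by rewrite gt_eqF// Gamma_gt0//; lra.
exact: ratio_rearrange.
Unshelve. all: by end_near. Qed.

End cseq_recurrence.

Section growth_sequence.
Context {R : realType} (b g : R).
Hypotheses (b_gtN1 : -1 < b) (b_lt_g : b < g) (g_lt : g < b + 1).

(** In the application [b = beta] and [g = p * (beta + 1)], and the walk grows like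
    this quotient. *)
Definition growth (n : nat) : R := cseq n g / cseq n b.

Let g_gtN1 : -1 < g. Proof. exact: lt_trans b_gtN1 b_lt_g. Qed.

Let natDb_gt0 (n : nat) : (0 < n)%N -> 0 < n%:R + b.
Proof.
move=> n0; have nR : 1 <= n%:R :> R by rewrite ler1n.
by move: b_gtN1; lra.
Qed.

Lemma growth_gt0 n : (0 < n)%N -> 0 < growth n.
Proof. by move=> n0; rewrite divr_gt0 ?cseq_gt0. Qed.

Lemma growth1 : growth 1 = 1.
Proof. by rewrite /growth !cseq1// divr1. Qed.

Lemma growthS n : (0 < n)%N ->
  growth n.+1 = growth n * ((n%:R + g) / (n%:R + b)).
Proof.
move=> n0; have c0 : cseq n b != 0 by rewrite gt_eqF ?cseq_gt0.
have n1 : n%:R != 0 :> R by rewrite pnatr_eq0 -lt0n.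
have nb : n%:R + b != 0 by rewrite gt_eqF// natDb_gt0.
rewrite /growth !cseqS//; move: c0 n1 nb.
move: (cseq n b) (cseq n g) (n%:R : R) => u v m u0 m0 mb0.
by rewrite -mulf_div (mulrC (m + g)) (mulrC (m + b)) -mulf_div divff ?invr_eq0// mul1r.
Qed.

Lemma growth_increment n : (0 < n)%N ->
  growth n.+1 - growth n = growth n * ((g - b) / (n%:R + b)).
Proof.
move=> n0; have nb : n%:R + b != 0 by rewrite gt_eqF// natDb_gt0.
by rewrite growthS//; move: nb; move: (growth n) (n%:R : R) => u m mb0; field.
Qed.

Lemma growth_leS n : (0 < n)%N -> growth n <= growth n.+1.
Proof.
move=> n0; rewrite -subr_ge0 growth_increment// mulr_ge0 ?(ltW (growth_gt0 _))//.
by rewrite divr_ge0 ?subr_ge0 ?ltW// natDb_gt0.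
Qed.

Lemma growth_le m n : (0 < m)%N -> (m <= n)%N -> growth m <= growth n.
Proof.
move=> m0 /subnK <-; elim: (n - m)%N => [//|k IH].
by apply: (le_trans IH); apply: growth_leS; rewrite addn_gt0 m0 orbT.
Qed.

Lemma growth_ge1 n : (0 < n)%N -> 1 <= growth n.
Proof. by move=> n0; rewrite -growth1 growth_le. Qed.

Let kappa := Gamma (b + 1) / Gamma (g + 1).

Let kappa_gt0 : 0 < kappa.
Proof. by rewrite divr_gt0 ?Gamma_gt0// -ltrBlDr sub0r. Qed.

Let cvg_growth_powR : growth n / n%:R `^ (g - b) @[n --> \oo] --> kappa.
Proof. by apply: cvg_growth => //; rewrite !ltW. Qed.

Let ratio_cancel (F : fieldType) (u v x y : F) :
  v != 0 -> x != 0 -> y != 0 ->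
  u / x / (v / y) * (x / y) = u / v.
Proof.
by move=> v0 x0 y0; field; rewrite v0 x0 y0.
Qed.

(** The power [q] makes [growth (j.+1 ^ q)] at least quadratic in [j]. *)
Lemma growth_power_ge : exists q : nat, (0 < q)%N /\ exists2 c : R, 0 < c &
  \forall j \near \oo, c * j.+1%:R ^+ 2 <= growth (j.+1 ^ q)%N.
Proof.
pose q := (Num.truncn (2 / (g - b))).+1.
have q2 : 2 <= q%:R * (g - b).
  by rewrite -ler_pdivrMr ?subr_gt0//; exact/ltW/truncnS_gt.
exists q; split => //; exists (kappa / 2); first by rewrite divr_gt0.
have hk : \forall n \near \oo, kappa / 2 <= growth n / n%:R `^ (g - b).
  have kk : kappa / 2 < kappa by rewrite gtr_pMr//; lra.
  near=> n; apply/ltW; near: n.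
  exact: (cvgr_gt _ cvg_growth_powR).
have [N _ HN] := hk.
near=> j.
have jN : (N <= j)%N by near: j; exact: nbhs_infty_ge.
have jq : (j < j.+1 ^ q)%N.
  by rewrite -[X in (X <= _)%N]expn1 leq_pexp2l.
have /HN := leq_trans jN (ltnW jq).
have p0 : 0 < (j.+1 ^ q)%:R `^ (g - b) :> R.
  by rewrite powR_gt0// ltr0n expn_gt0.
rewrite /= ler_pdivlMr// => /(le_trans _); apply.
rewrite ler_wpM2l ?(ltW (divr_gt0 _ _))//.
rewrite natrX -[_ ^+ q]powR_mulrn// -powRrM -powR_mulrn//.
by apply: ler_powR => //; rewrite ler1n.
Unshelve. all: by end_near. Qed.

(** The times [j.+1 ^ q] are nevertheless dense enough that [growth] varies by a
    factor tending to 1 between consecutive ones. *)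
Lemma cvg_growth_power_ratio (q : nat) : (0 < q)%N ->
  growth (j.+2 ^ q)%N / growth (j.+1 ^ q)%N @[j --> \oo] --> (1 : R).
Proof.
move=> q0.
have subseq (i : nat) :
    growth ((j + i) ^ q)%N / ((j + i) ^ q)%:R `^ (g - b) @[j --> \oo] --> kappa.
  apply: (cvg_comp (fun j => (j + i) ^ q)%N
    (fun n => growth n / n%:R `^ (g - b)) _ cvg_growth_powR).
  apply/cvgnyPge => A; near=> j.
  have jA : (A <= j)%N by near: j; exact: nbhs_infty_ge.
  apply: (leq_trans jA); apply: (leq_trans (leq_addr i j)).
  by case: (j + i)%N => // m; rewrite -[X in (X <= _)%N]expn1 leq_pexp2l.
have ratio : ((j.+1%:R + 1) / j.+1%:R) `^ (q%:R * (g - b)) @[j --> \oo] --> (1 : R).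
  have c1 : (j.+1%:R + 1) / j.+1%:R @[j --> \oo] --> (1 : R).
    by have := @cvg_natD_div R 1; rewrite -cvg_shiftS.
  have := @continuous_cvg nat R R \oo _ (fun j => (j.+1%:R + 1) / j.+1%:R)
    (@powR R ^~ (q%:R * (g - b))) 1 (continuous_powR_gt0 ltr01) c1.
  by rewrite powR1; apply.
have h : (growth ((j + 2) ^ q)%N / ((j + 2) ^ q)%:R `^ (g - b)) /
         (growth ((j + 1) ^ q)%N / ((j + 1) ^ q)%:R `^ (g - b)) *
         ((j.+1%:R + 1) / j.+1%:R) `^ (q%:R * (g - b)) @[j --> \oo] --> (1 : R).
  rewrite -[X in _ --> X]mulr1; apply: cvgM => //.
  have k0 : kappa != 0 by rewrite gt_eqF.
  rewrite -[X in _ --> X](mulfV k0).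
  by apply: cvgM => //; apply: cvgV.
apply: cvg_trans h; apply: near_eq_cvg; near=> j.
rewrite addn2 addn1 natr1.
have pow_exp (i : nat) :
    (i.+1 ^ q)%:R `^ (g - b) = i.+1%:R `^ (q%:R * (g - b)) :> R.
  by rewrite natrX -[_ ^+ q]powR_mulrn// -powRrM.
rewrite !pow_exp powRM ?invr_ge0//.
have -> : (j.+1%:R^-1 : R) `^ (q%:R * (g - b)) =
    (j.+1%:R `^ (q%:R * (g - b)))^-1.
  by rewrite -powR_inv1// powRAC powR_inv1// powR_ge0.
have p1 : j.+1%:R `^ (q%:R * (g - b)) != 0 :> R by rewrite gt_eqF ?powR_gt0.
have p2 : j.+2%:R `^ (q%:R * (g - b)) != 0 :> R by rewrite gt_eqF ?powR_gt0.
by apply: ratio_cancel => //; rewrite gt_eqF ?growth_gt0// expn_gt0.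
Unshelve. all: by end_near. Qed.

End growth_sequence.

Lemma cvg_growth_pinfty {R : realType} (b g : R) :
  -1 < b -> b < g -> g < b + 1 -> growth b g n @[n --> \oo] --> +oo.
Proof.
move=> b1 bg gb; have [q [q0 [c c0 [N _ HN]]]] := growth_power_ge b1 bg gb.
apply/cvgryPge => A.
pose j := maxn N (Num.truncn (`|A| / c)).
have jA : A <= c * j.+1%:R ^+ 2.
  have h : `|A| / c <= j.+1%:R.
    by apply/ltW/(lt_le_trans (truncnS_gt _)); rewrite ler_nat ltnS leq_maxr.
  rewrite mulrC -ler_pdivrMr//; apply: (@le_trans _ _ (`|A| / c)).
    by rewrite ler_wpM2r ?invr_ge0 ?(ltW c0)// ler_norm.
  apply: (le_trans h); rewrite expr2 ler_peMr// ler1n//.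
near=> n; apply: (le_trans jA); apply: (le_trans (HN j (leq_maxl _ _))).
apply: growth_le => //; first by rewrite expn_gt0.
by near: n; exact: nbhs_infty_ge.
Unshelve. all: by end_near. Qed.

(** * Averaging and interpolation *)

(** Stolz--Cesaro in averaged form: the weights [s k.+1 - s k] have total mass
    equivalent to [s n], and every finite initial segment becomes negligible. *)
Lemma cvg_weighted_mean {R : realType} (s m : nat -> R) (l : R) :
  (forall n, (0 < n)%N -> 0 < s n) ->
  (forall n, (0 < n)%N -> s n <= s n.+1) ->
  s n @[n --> \oo] --> +oo -> m n @[n --> \oo] --> l ->
  (\sum_(1 <= k < n) (s k.+1 - s k) * m k) / s n @[n --> \oo] --> l.
Proof.
move=> s0 sS soo ml; apply/cvgrPdist_le => e e0.
have e2 : 0 < e / 2 by rewrite divr_gt0.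
move/cvgrPdist_le : ml => /(_ _ e2) [N1 _ HN1].
pose N := maxn N1 1.
pose u n := \sum_(1 <= k < n) (s k.+1 - s k) * (m k - l).
have ds k : (0 < k)%N -> 0 <= s k.+1 - s k by move=> k0; rewrite subr_ge0 sS.
have N0 : (0 < N)%N by rewrite leq_maxr.
have uN n : (N <= n)%N -> `|u n| <= `|u N| + e / 2 * s n.
  move=> Nn; rewrite /u (@big_cat_nat _ _ _ N)//= -/(u N).
  apply: (le_trans (ler_normD _ _)); rewrite lerD2l.
  apply: (le_trans (ler_norm_sum _ _ _)).
  apply: (@le_trans _ _ (\sum_(N <= k < n) e / 2 * (s k.+1 - s k))).
    rewrite big_nat_cond [leRHS]big_nat_cond; apply: ler_sum => k.
    rewrite andbT => /andP[Nk _]; have k0 := leq_trans N0 Nk.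
    rewrite normrM (ger0_norm (ds _ k0)) mulrC ler_wpM2r ?ds// distrC.
    by apply: HN1; exact: leq_trans (leq_maxl _ _) Nk.
  rewrite -mulr_sumr telescope_sumr// ler_wpM2l ?(ltW e2)//.
  by rewrite gerBl ltW// s0.
have id n : (0 < n)%N ->
    \sum_(1 <= k < n) (s k.+1 - s k) * m k = u n + l * (s n - s 1%N).
  move=> n0; rewrite -(telescope_sumr _ n0) mulr_sumr -big_split/=.
  by apply: eq_bigr => k _; rewrite mulrBr [l * _]mulrC subrK.
pose K := `|l * s 1%N| + `|u N|.
near=> n.
have Nn : (N <= n)%N by near: n; exact: nbhs_infty_ge.
have n0 : (0 < n)%N by exact: leq_trans Nn.
have sn := s0 n n0.
have snK : K / (e / 2) <= s n by near: n; move/cvgryPge : soo; exact.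
rewrite id//.
have -> : l - (u n + l * (s n - s 1%N)) / s n = (l * s 1%N - u n) / s n.
  by field; rewrite gt_eqF.
rewrite normf_div (gtr0_norm sn) ler_pdivrMr//.
apply: (le_trans (ler_normB _ _)).
rewrite ler_pdivrMr// in snK.
have := uN n Nn; rewrite /K in snK; lra.
Unshelve. all: by end_near. Qed.

(** Between two consecutive points of the subsequence [nu], the ratio [f / s]
    is trapped by monotonicity between [f (nu j) / s (nu j.+1)] and
    [f (nu j.+1) / s (nu j)]. *)
Lemma cvg_monotone_interpolation {R : realType} (f s : nat -> R)
    (nu : nat -> nat) (l : R) :
  (forall n, 0 <= f n) ->
  (forall m n, (m <= n)%N -> f m <= f n) ->
  (forall n, (0 < n)%N -> 0 < s n) ->
  (forall m n, (0 < m)%N -> (m <= n)%N -> s m <= s n) ->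
  (forall j, (j < nu j)%N) ->
  s (nu j.+1) / s (nu j) @[j --> \oo] --> (1 : R) ->
  f (nu j) / s (nu j) @[j --> \oo] --> l ->
  f n / s n @[n --> \oo] --> l.
Proof.
move=> f0 fle s0 sle nuj s1 fl.
have nu0 j : (0 < nu j)%N by exact: leq_ltn_trans (nuj j).
have snu0 j : s (nu j) != 0 by rewrite gt_eqF// s0.
have up : f (nu j.+1) / s (nu j) @[j --> \oo] --> l.
  have h : f (nu j.+1) / s (nu j.+1) * (s (nu j.+1) / s (nu j)) @[j --> \oo] --> l.
    by rewrite -[X in _ --> X]mulr1; apply: cvgM => //; move: fl; rewrite -cvg_shiftS.
  apply: cvg_trans h; apply: near_eq_cvg; near=> j.
  by rewrite mulrA mulfVK.
have lo : f (nu j) / s (nu j.+1) @[j --> \oo] --> l.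
  have h : f (nu j) / s (nu j) / (s (nu j.+1) / s (nu j)) @[j --> \oo] --> l.
    rewrite -[X in _ --> X]divr1; apply: cvgM => //.
    by apply: cvgV => //; exact: oner_neq0.
  apply: cvg_trans h; apply: near_eq_cvg; near=> j.
  by rewrite invf_div mulrA mulfVK.
apply/cvgrPdist_le => e e0.
move/cvgrPdist_le : up => /(_ _ e0) [J1 _ HJ1].
move/cvgrPdist_le : lo => /(_ _ e0) [J2 _ HJ2].
pose J := maxn J1 J2.
near=> n.
have Jn : (nu J <= n)%N by near: n; exact: nbhs_infty_ge.
have [j [Jj jn nj]] : exists j, [/\ (J <= j)%N, (nu j <= n)%N & (n < nu j.+1)%N].
  have ex : exists i, (J <= i)%N && (nu i <= n)%N by exists J; rewrite leqnn.
  have bd i : (J <= i)%N && (nu i <= n)%N -> (i <= n)%N.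
    by move=> /andP[_]; apply: leq_trans; exact: ltnW.
  case: (ex_maxnP ex bd) => j /andP[Jj jn] jmax; exists j; split => //.
  rewrite ltnNge; apply/negP => jn1.
  by have := jmax j.+1; rewrite (leqW Jj) jn1 ltnn => /(_ isT).
have n0 : (0 < n)%N by exact: leq_trans jn.
have sn := s0 n n0.
have h1 : f n / s n <= f (nu j.+1) / s (nu j).
  apply: ler_pM; rewrite ?invr_ge0 ?(ltW sn) ?f0//; first by apply: fle; exact: ltnW.
  by rewrite lef_pV2 ?posrE ?s0// sle.
have h2 : f (nu j) / s (nu j.+1) <= f n / s n.
  apply: ler_pM; rewrite ?invr_ge0 ?(ltW (s0 _ (nu0 _))) ?f0//; first exact: fle.
  by rewrite lef_pV2 ?posrE ?s0//; apply: sle => //; exact: ltnW.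
have := HJ1 j (leq_trans (leq_maxl _ _) Jj).
have := HJ2 j (leq_trans (leq_maxr _ _) Jj).
rewrite /= !ler_distl => /andP[a1 a2] /andP[a3 a4].
by apply/andP; split; lra.
Unshelve. all: by end_near. Qed.

(** A nondecreasing [f] inherits the growth of its compensator [A], a weighted sum
    of a convergent sequence, as soon as [f - A] is negligible along [nu]. *)
Lemma cvg_of_compensator {R : realType} (f A s m : nat -> R) (nu : nat -> nat)
    (K l : R) :
  (forall n, 0 <= f n) -> (forall n, f n <= f n.+1) ->
  (forall n, (0 < n)%N -> 0 < s n) ->
  (forall n, (0 < n)%N -> s n <= s n.+1) ->
  s n @[n --> \oo] --> +oo ->
  (forall j, (j < nu j)%N) ->
  s (nu j.+1) / s (nu j) @[j --> \oo] --> (1 : R) ->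
  (forall n, A n = K * \sum_(1 <= k < n) (s k.+1 - s k) * m k) ->
  (f (nu j) - A (nu j)) / s (nu j) @[j --> \oo] --> (0 : R) ->
  m n @[n --> \oo] --> l ->
  f n / s n @[n --> \oo] --> K * l.
Proof.
move=> f0 fS s0 sS soo nuj ratio AE fA ml.
have le_of_leS (u : nat -> R) (i : nat) : (forall n, (i <= n)%N -> u n <= u n.+1) ->
    forall k n, (i <= k)%N -> (k <= n)%N -> u k <= u n.
  move=> uS k n ik /subnK <-; elim: (n - k)%N => [//|t IH].
  by apply: (le_trans IH); apply: uS; exact: leq_trans (leq_addl _ _).
have comp : A n / s n @[n --> \oo] --> K * l.
  under eq_fun do rewrite AE -mulrA.
  by apply: cvgM; [exact: cvg_cst|exact: cvg_weighted_mean].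
apply: (@cvg_monotone_interpolation R f s nu) => //.
- by move=> k n; apply: (le_of_leS f 0%N).
- exact: (le_of_leS s 1%N).
have h : (f (nu j) - A (nu j)) / s (nu j) + A (nu j) / s (nu j) @[j --> \oo]
    --> K * l.
  rewrite -[K * l]add0r; apply: cvgD => //.
  apply: (cvg_comp nu (fun n => A n / s n) _ comp).
  by apply/cvgnyPge => B; near=> j; apply/ltnW/(leq_ltn_trans _ (nuj j));
     near: j; exact: nbhs_infty_ge.
apply: cvg_trans h; apply: near_eq_cvg; near=> j.
by rewrite -mulrDl subrK.
Unshelve. all: by end_near. Qed.

(** * Means of bounded random variables *)

Section bounded_expectation.
Context d (T : measurableType d) {R : realType} (P : probability T R).
Implicit Types f g : T -> R.

(** Boundedness makes integrability automatic under every algebraic operation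
    that occurs in the moment computations. *)
Definition bdd_meas f :=
  measurable_fun setT f /\ exists c : R, forall w, `|f w| <= c.

Definition mean f : R := \int[P]_w f w.

Lemma bdd_meas_integrable f : bdd_meas f -> P.-integrable setT (EFin \o f).
Proof.
move=> [mf [c fc]]; apply: measurable_bounded_integrable => //.
  exact: le_lt_trans (probability_le1 P measurableT) (ltry 1).
exists c; split; first exact: num_real.
by move=> M cM w _ /=; exact: le_trans (fc w) (ltW cM).
Qed.

Lemma bdd_meas_cst (c : R) : bdd_meas (fun=> c).
Proof. by split; [exact: measurable_cst|exists `|c|]. Qed.

Lemma bdd_meas_indic (A : set T) : measurable A -> bdd_meas \1_A.
Proof.
move=> mA; split; first exact: measurable_indic.
by exists 1 => w; rewrite indicE; case: (_ \in _); rewrite ?normr1 ?normr0.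
Qed.

Lemma bdd_measD f g : bdd_meas f -> bdd_meas g -> bdd_meas (fun w => f w + g w).
Proof.
move=> [mf [a fa]] [mg [b gb]]; split; first exact: measurable_funD.
by exists (a + b) => w; apply: (le_trans (ler_normD _ _)); exact: lerD.
Qed.

Lemma bdd_measM f g : bdd_meas f -> bdd_meas g -> bdd_meas (fun w => f w * g w).
Proof.
move=> [mf [a fa]] [mg [b gb]]; split; first exact: measurable_funM.
by exists (a * b) => w; rewrite normrM; exact: ler_pM.
Qed.

Lemma bdd_measZ c f : bdd_meas f -> bdd_meas (fun w => c * f w).
Proof. by apply: bdd_measM; exact: bdd_meas_cst. Qed.

Lemma bdd_meas_sum (I : Type) (r : seq I) (F : I -> T -> R) :
  (forall i, bdd_meas (F i)) -> bdd_meas (fun w => \sum_(i <- r) F i w).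
Proof.
move=> bF; elim: r => [|i r IH].
  by under eq_fun do rewrite big_nil; exact: bdd_meas_cst.
by under eq_fun do rewrite big_cons; exact: bdd_measD.
Qed.

Lemma meanD f g : bdd_meas f -> bdd_meas g ->
  mean (fun w => f w + g w) = mean f + mean g.
Proof.
by move=> /bdd_meas_integrable bf /bdd_meas_integrable bg; exact: RintegralD.
Qed.

Lemma meanZ c f : bdd_meas f -> mean (fun w => c * f w) = c * mean f.
Proof. by move=> /bdd_meas_integrable bf; exact: RintegralZl. Qed.

Lemma mean_cst c : mean (fun=> c) = c.
Proof.
rewrite /mean Rintegral_cst//.
have -> : fine (P setT) = 1 by rewrite probability_setT.
by rewrite mulr1.
Qed.

Lemma mean_sum (I : Type) (r : seq I) (F : I -> T -> R) :
  (forall i, bdd_meas (F i)) ->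
  mean (fun w => \sum_(i <- r) F i w) = \sum_(i <- r) mean (F i).
Proof.
move=> bF; elim: r => [|i r IH].
  by under eq_fun do rewrite big_nil; rewrite big_nil mean_cst.
under eq_fun do rewrite big_cons.
by rewrite big_cons meanD ?IH//; exact: bdd_meas_sum.
Qed.

Lemma mean_le f g : bdd_meas f -> bdd_meas g -> (forall w, f w <= g w) ->
  mean f <= mean g.
Proof.
move=> /bdd_meas_integrable bf /bdd_meas_integrable bg fg.
by apply: le_Rintegral => // w _.
Qed.

Lemma mean_ge0 f : (forall w, 0 <= f w) -> 0 <= mean f.
Proof. by move=> f0; apply: Rintegral_ge0 => w _. Qed.

Lemma mean_indic (A : set T) : measurable A -> mean \1_A = fine (P A).
Proof.
by move=> mA; rewrite /mean /Rintegral integral_indic// setIT.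
Qed.

Lemma mean_fineE f : bdd_meas f -> (\int[P]_w (f w)%:E)%E = (mean f)%:E.
Proof.
move=> bf; rewrite /mean /Rintegral fineK//.
exact: (integrable_fin_num _ (bdd_meas_integrable bf)).
Qed.

(** Borel--Cantelli in the mean: [mean (Z j)] is summable, hence
    [\sum_j Z j] is almost surely finite and its terms vanish. *)
Lemma cvg0_of_mean_summable (Z : nat -> T -> R) (c : R) :
  (forall j, bdd_meas (Z j)) -> (forall j w, 0 <= Z j w) ->
  (forall j, mean (Z j) <= c / j.+1%:R ^+ 2) ->
  {ae P, forall w, Z j w @[j --> \oo] --> (0 : R)}.
Proof.
move=> bZ Z0 Zc.
have c0 : 0 <= c.
  have := Zc 0%N; rewrite expr1n divr1; apply: le_trans.
  exact: mean_ge0.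
have sumle n : \sum_(0 <= j < n) c / j.+1%:R ^+ 2 <= 2 * c.
  (* Comparison with the telescoping sum of [1 / j - 1 / j.+1]. *)
  have step k : \sum_(0 <= j < k.+1) c / j.+1%:R ^+ 2 <= (2 - k.+1%:R^-1) * c.
    elim: k => [|k IH]; first by rewrite big_nat1 expr1n invr1; lra.
    rewrite big_nat_recr//=; apply: (le_trans (lerD IH (lexx _))).
    rewrite [c / _]mulrC -mulrDl ler_wpM2r//.
    have k0 : 0 < k.+1%:R :> R by [].
    rewrite -[k.+2%:R]natr1; move: (k.+1%:R : R) k0 => a a0.
    rewrite -subr_ge0.
    have -> : 2 - (a + 1)^-1 - (2 - a^-1 + ((a + 1) ^+ 2)^-1) =
              (a * (a + 1) ^+ 2)^-1.
      by field; rewrite !gt_eqF//; lra.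
    by rewrite invr_ge0 mulr_ge0 ?exprn_ge0//; lra.
  case: n => [|n]; first by rewrite big_nil; lra.
  apply: (le_trans (step n)); rewrite ler_wpM2r//.
  by rewrite gerBl invr_ge0.
pose S w := (\sum_(0 <= j <oo) (Z j w)%:E)%E.
have mZ j : measurable_fun setT (EFin \o Z j).
  by apply/measurable_EFinP; exact: (bZ j).1.
have intS : (\int[P]_w S w < +oo)%E.
  rewrite /S integral_nneseries//; last by move=> j w _; rewrite lee_fin.
  apply: (@le_lt_trans _ _ (2 * c)%:E); last exact: ltry.
  apply: lime_le.
    by apply: is_cvg_nneseries => j _ _; apply: integral_ge0 => w _; rewrite lee_fin.
  apply: nearW => n.
  under eq_bigr => j _ do rewrite mean_fineE//.
  rewrite sumEFin lee_fin; apply: le_trans (sumle n).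
  by apply: ler_sum => j _.
have S0 w : (0 <= S w)%E by apply: nneseries_ge0 => j _ _; rewrite lee_fin.
have mS : measurable_fun setT S.
  apply: ge0_emeasurable_sum => [j w _ _|j _]; first by rewrite lee_fin.
  exact: mZ.
have iS : P.-integrable setT S.
  apply/integrableP; split => //.
  by under eq_integral do rewrite gee0_abs//.
apply: filterS (integrable_ae measurableT iS) => w /(_ I) Sfin.
apply: cvg_series_cvg_0; apply: nondecreasing_is_cvgn.
  by apply/nondecreasing_seqP => n; rewrite seriesSr lerDl.
exists (fine (S w)) => _ [n _ <-].
rewrite -lee_fin fineK// /series/= -sumEFin.
by apply: nneseries_lim_ge => j _ _; rewrite lee_fin.
Qed.

End bounded_expectation.

(** * The steps as a function of the recalled times *)

Section history.
Context d (T : measurableType d) {R : realType} (P : probability T R).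
Variables (alpha : nat -> {RV P >-> bool}) (recall : nat -> {RV P >-> nat}).

Definition repeats (k i : nat) : set T :=
  alpha k @^-1` [set true] `&` recall k @^-1` [set i].

Lemma measurable_repeats k i : measurable (repeats k i).
Proof. by apply: measurableI; apply: measurable_funPTI. Qed.

Definition repeat_pattern (r : nat -> nat) (J : seq nat) (w : T) : R :=
  \prod_(k <- J) \1_(repeats k (r k)) w.

Lemma repeat_patternE r J :
  repeat_pattern r J = \1_(\bigcap_(k in [set` J]) repeats k (r k)).
Proof.
rewrite bigcap_seq; elim: J => [|k J IH]; apply/funext => w.
  by rewrite /repeat_pattern !big_nil indicT.
rewrite /repeat_pattern !big_cons indicI /=; congr (_ * _).
exact: (congr1 (fun f => f w) IH).
Qed.

Lemma bdd_meas_repeat_pattern r J : bdd_meas (repeat_pattern r J).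
Proof.
rewrite repeat_patternE bigcap_seq; apply: bdd_meas_indic.
by apply: bigsetI_measurable => k _; exact: measurable_repeats.
Qed.

Lemma sigma_generated_cylinder d' (T' : measurableType d') (D : set nat)
    (Y : nat -> T -> T') (J : seq nat) (A : nat -> set T') :
  (forall k, k \in J -> D k) -> (forall k, measurable (A k)) ->
  sigma_generated D Y (\bigcap_(k in [set` J]) (Y k @^-1` A k)).
Proof.
move=> JD mA; rewrite /sigma_generated bigcap_seq big_seq.
set G := \bigcup_(n in D) _.
apply: (@bigsetI_measurable _ (g_sigma_algebraType G)) => k kJ.
apply: sub_sigma_algebra; exists k; first exact: JD.
by exists (A k) => //; rewrite setTI.
Qed.

(** A step function driven by the same randomness as the walk, but which takes
    values in [{0, 1}] everywhere and not only almost surely.  The list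
    [steps_upto k w] holds the steps at times [0 .. k.+1], with the dummy step [0]
    at time [0]. *)
Fixpoint steps_upto (k : nat) (w : T) : seq R :=
  if k is k'.+1 then
    rcons (steps_upto k' w)
      ((alpha k.+1 w)%:R * nth 0 (steps_upto k' w) (recall k.+1 w))
  else [:: 0; 1].

Definition step (n : nat) (w : T) : R := nth 0 (steps_upto n w) n.

Lemma size_steps_upto k w : size (steps_upto k w) = k.+2.
Proof. by elim: k => //= k IH; rewrite size_rcons IH. Qed.

Lemma nth_steps_upto k i w : (i < k.+2)%N -> nth 0 (steps_upto k w) i = step i w.
Proof.
elim: k i => [|k IH] i; first by case: i => [|[|i]].
rewrite ltnS leq_eqVlt => /predU1P[->|ik]; last first.
  by rewrite /= nth_rcons size_steps_upto ik IH.
by rewrite /step -[steps_upto k.+2 w]/(rcons (steps_upto k.+1 w) _) [RHS]nth_rcons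
  size_steps_upto ltnSn.
Qed.

Lemma step_0 w : step 0 w = 0. Proof. by []. Qed.
Lemma step_1 w : step 1 w = 1. Proof. by []. Qed.

Lemma step_recall n w : (0 < n)%N ->
  step n.+1 w = (alpha n.+1 w)%:R *
    (if (recall n.+1 w < n.+1)%N then step (recall n.+1 w) w else 0).
Proof.
case: n => // n _; rewrite -(nth_steps_upto (k := n.+1))// /= nth_rcons.
rewrite size_steps_upto ltnn eqxx; congr (_ * _).
case: ifPn => h; first by rewrite nth_steps_upto.
by rewrite nth_default// size_steps_upto leqNgt.
Qed.

Lemma stepS_sum n w : (0 < n)%N ->
  step n.+1 w = \sum_(1 <= i < n.+1) \1_(repeats n.+1 i) w * step i w.
Proof.
move=> n0; rewrite step_recall//.
have E i : \1_(repeats n.+1 i) w = (alpha n.+1 w)%:R * (recall n.+1 w == i)%:R :> R.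
  rewrite indicE -natrM mulnb; congr (_%:R); congr nat_of_bool.
  by apply/idP/andP => [/set_mem[/= -> ->]|[a /eqP b]]; [rewrite eqxx|apply/mem_set].
under eq_bigr do rewrite E -mulrA; rewrite -mulr_sumr; congr (_ * _).
case: ifPn => h; last first.
  rewrite big_nat_cond big1// => i /andP[/andP[_ ilt] _].
  by case: eqP => [ri|_]; [rewrite ri ilt in h|rewrite mul0r].
have [r0|r0] := posnP (recall n.+1 w).
  rewrite r0 step_0 big_nat_cond big1// => i /andP[/andP[i0 _] _].
  by case: eqP => [ri|_]; [rewrite -ri in i0|rewrite mul0r].
rewrite (bigD1_seq (recall n.+1 w)) ?mem_index_iota ?r0 ?h ?iota_uniq//=.
rewrite eqxx mul1r big1 ?addr0// => i /negbTE; rewrite eq_sym => ->.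
by rewrite mul0r.
Qed.

Lemma step01 n w : step n w = 0 \/ step n w = 1.
Proof.
have [m] := ubnP n; elim: m n => // m IH [|[|n]] nm; [by left|by right|].
rewrite step_recall//; case: (alpha _ _); last by left; rewrite mul0r.
rewrite mul1r; case: ifPn => [h|_]; last by left.
by apply: IH; rewrite ltnS in nm; exact: leq_trans nm.
Qed.

Lemma step_ge0 n w : 0 <= step n w.
Proof. by case: (step01 n w) => ->. Qed.

Lemma step_idem n w : step n w * step n w = step n w.
Proof. by case: (step01 n w) => ->; rewrite ?mulr0 ?mulr1. Qed.

Lemma bdd_meas_step n : bdd_meas (step n).
Proof.
have [m] := ubnP n; elim: m n => // m IH [|[|n]] nm.
- exact: bdd_meas_cst.
- exact: bdd_meas_cst.
rewrite (_ : step n.+2 = fun w =>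
    \sum_(i <- index_iota 1 n.+2) (if (i < n.+2)%N then
       \1_(repeats n.+2 i) w * step i w else 0)); last first.
  apply/funext => w; rewrite stepS_sum// big_nat_cond [RHS]big_nat_cond.
  by apply: eq_bigr => i /andP[/andP[_ ->]].
apply: bdd_meas_sum => i; have [h|h] := boolP (i < n.+2)%N; last exact: bdd_meas_cst.
apply: bdd_measM; first exact/bdd_meas_indic/measurable_repeats.
by apply: IH; exact: leq_trans h _.
Qed.

End history.

(** * Independence of the past and the future *)

Section elephant.
Context d (T : measurableType d) {R : realType} (P : probability T R).
Variables (p beta : R) (alpha : nat -> {RV P >-> bool})
  (recall : nat -> {RV P >-> nat}) (X : nat -> {RV P >-> R}).
Hypotheses (p_gt0 : 0 < p) (p_lt1 : p < 1) (beta_gtN1 : -1 < beta).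
Hypothesis HX : laziest_erw p beta alpha recall X.

Local Notation step := (step alpha recall).
Local Notation repeats := (repeats alpha recall).
Local Notation repeat_pattern := (repeat_pattern alpha recall).

(** The value of [P (repeats k i)] for [2 <= k], as [alpha k] and [recall k] are
    independent. *)
Definition repeat_prob (k i : nat) : R :=
  p * fine (P (recall k @^-1` [set i])).

Lemma alpha_true_prob k : (2 <= k)%N -> P (alpha k @^-1` [set true]) = p%:E.
Proof.
case: k => [//|k]; rewrite ltnS => k1.
have := congr1 (fun f : set bool -> \bar R => f [set true])
               (alpha_bernoulli HX k1).
rewrite /distribution /pushforward => ->.
rewrite bernoulli_probE ?(ltW p_gt0) ?(ltW p_lt1)//.
by rewrite !diracE mem_set// memNset//= mule1 mule0 adde0.
Qed.

Lemma mean_repeat_pattern r J : uniq J -> (forall k, k \in J -> (2 <= k)%N) ->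
  mean P (repeat_pattern r J) = \prod_(k <- J) repeat_prob k (r k).
Proof.
move=> uJ J2; rewrite repeat_patternE mean_indic; last first.
  by rewrite bigcap_seq; apply: bigsetI_measurable => k _; exact: measurable_repeats.
have recall_fin (k : nat) : P (recall k @^-1` [set r k]) \is a fin_num.
  by apply: fin_num_measure; exact: measurable_funPTI.
rewrite /repeats bigcapI (alpha_recall_indep HX); last 2 first.
- exact: (sigma_generated_cylinder (A := fun=> [set true])).
- exact: (sigma_generated_cylinder (A := fun k => [set r k])).
rewrite (alpha_indep HX (A := fun=> [set true]))//.
rewrite (recall_indep HX (A := fun k => [set r k]))//.
rewrite -big_split/= big_seq.
have -> : (\prod_(k <- J | k \in J)
     (P (alpha k @^-1` [set true]) * P (recall k @^-1` [set r k])) =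
     (\prod_(k <- J | k \in J) repeat_prob k (r k))%:E)%E.
  rewrite -prodEFin; apply: eq_bigr => k kJ.
  by rewrite alpha_true_prob ?J2// -(fineK (recall_fin k)).
by rewrite /= -big_seq.
Qed.

Lemma mean_repeat_cons r k J : (2 <= k)%N -> uniq (k :: J) ->
  (forall i, i \in J -> (2 <= i)%N) ->
  mean P (repeat_pattern r (k :: J)) =
  repeat_prob k (r k) * mean P (repeat_pattern r J).
Proof.
move=> k2 uJ J2; have /andP[_ uJ'] := uJ.
have kJ2 i : i \in k :: J -> (2 <= i)%N.
  by rewrite inE => /predU1P[->//|]; exact: J2.
by rewrite !mean_repeat_pattern// big_cons.
Qed.

Let bstep := @bdd_meas_step d T R P alpha recall.
Let bpat := @bdd_meas_repeat_pattern d T R P alpha recall.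
Let bstep2 j k : bdd_meas (fun w => step j w * step k w).
Proof. exact: bdd_measM. Qed.

(** Conditioning on the present: products of past steps are independent of the
    future repeat events.  The induction on the present time [m] exposes step
    [m.+1] as a sum over the recalled time [i] and transfers the event that it
    repeats step [i] to the future. *)
Lemma past_future_indep m j k r J :
  (0 < j <= m)%N -> (0 < k <= m)%N -> uniq J -> (forall i, i \in J -> (m < i)%N) ->
  mean P (fun w => step j w * step k w * repeat_pattern r J w) =
  mean P (fun w => step j w * step k w) * mean P (repeat_pattern r J).
Proof.
elim: m j k r J => [j|m IH] ; first by case: j.
have [m0 j k r J|m0] := posnP m.
  rewrite m0; case: j => [|[|//]]//= _; case: k => [|[|//]]//= _ uJ Jm.
  have -> : (fun w => step 1 w * step 1 w) = fun=> 1.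
    by apply/funext => w; rewrite step_1 mulr1.
  rewrite mean_cst mul1r; congr (mean _ _).
  by apply/funext => w; rewrite step_1 !mul1r.
have split_last j r J : (0 < j <= m)%N -> uniq J ->
    (forall i, i \in J -> (m.+1 < i)%N) ->
    mean P (fun w => step j w * step m.+1 w * repeat_pattern r J w) =
    (\sum_(1 <= i < m.+1) repeat_prob m.+1 i * mean P (fun w => step j w * step i w))
      * mean P (repeat_pattern r J).
  move=> jm uJ Jm.
  pose r' i := fun l => if l == m.+1 then i else r l.
  have mJ : m.+1 \notin J by apply/negP => /Jm; rewrite ltnn.
  have r'J i w : repeat_pattern (r' i) (m.+1 :: J) w =
                 \1_(repeats m.+1 i) w * repeat_pattern r J w.
    rewrite /repeat_pattern big_cons {1}/r' eqxx; congr (_ * _).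
    apply: eq_big_seq => l lJ; rewrite /r'; case: eqP => // lm.
    by rewrite lm (negbTE mJ) in lJ.
  rewrite (_ : (fun w => step j w * step m.+1 w * repeat_pattern r J w) =
      fun w => \sum_(i <- index_iota 1 m.+1)
        step j w * step i w * repeat_pattern (r' i) (m.+1 :: J) w); last first.
    apply/funext => w; rewrite stepS_sum// mulr_sumr mulr_suml.
    by apply: eq_bigr => i _; rewrite r'J; ring.
  rewrite mean_sum; last by move=> i; apply: bdd_measM.
  rewrite mulr_suml big_nat_cond [RHS]big_nat_cond.
  apply: eq_bigr => i /andP[/andP[i0 im] _].
  rewrite IH ?i0//=; last 2 first.
  - by rewrite mJ.
  - by move=> l; rewrite inE => /predU1P[->//|/Jm]; exact: ltnW.
  rewrite mean_repeat_cons//=; [|by rewrite mJ|]; last first.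
    by move=> l /Jm; apply: leq_trans.
  rewrite {1}/r' eqxx mulrA [mean P _ * _]mulrC; congr (_ * _ * mean P _).
  apply/funext => w; apply: eq_big_seq => l lJ; rewrite /r'; case: eqP => // lm.
  by rewrite lm (negbTE mJ) in lJ.
have mean_last j : (0 < j <= m)%N -> mean P (fun w => step j w * step m.+1 w) =
    \sum_(1 <= i < m.+1) repeat_prob m.+1 i * mean P (fun w => step j w * step i w).
  have nilm i : i \in [::] -> (m.+1 < i)%N by [].
  move=> jm; have := split_last j id [::] jm isT nilm.
  have -> : repeat_pattern id [::] = fun=> 1.
    by apply/funext => w; rewrite /repeat_pattern big_nil.
  rewrite mean_cst mulr1 => <-; congr (mean _ _).
  by apply/funext => w; rewrite mulr1.
have last_case j r J : (0 < j <= m)%N -> uniq J ->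
    (forall i, i \in J -> (m.+1 < i)%N) ->
    mean P (fun w => step j w * step m.+1 w * repeat_pattern r J w) =
    mean P (fun w => step j w * step m.+1 w) * mean P (repeat_pattern r J).
  by move=> jm uJ Jm; rewrite split_last// mean_last.
move=> j k r J /andP[j0 jm] /andP[k0 km] uJ Jm.
move: jm; rewrite leq_eqVlt ltnS => /predU1P[jE|jm];
  move: km; rewrite leq_eqVlt ltnS => /predU1P[kE|km].
- (* [step m.+1] is idempotent and [step 1 = 1], so this is the pair [1, m.+1]. *)
  rewrite jE kE.
  have -> : (fun w => step m.+1 w * step m.+1 w) =
            fun w => step 1 w * step m.+1 w.
    by apply/funext => w; rewrite step_idem step_1 mul1r.
  rewrite -last_case//; congr (mean _ _).
  by apply/funext => w; rewrite step_idem step_1 mul1r.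
- rewrite jE; have -> : (fun w => step m.+1 w * step k w) =
            fun w => step k w * step m.+1 w.
    by apply/funext => w; rewrite mulrC.
  rewrite -last_case ?k0//; congr (mean _ _).
  by apply/funext => w; rewrite [step m.+1 w * _]mulrC.
- by rewrite kE last_case ?j0.
- by rewrite IH ?j0 ?k0// => i /Jm; exact: ltnW.
Qed.

(** * First and second moments *)

Lemma mu_gt0 n : (0 < n)%N -> 0 < mu_ beta n.
Proof. by move=> n0; exact: cseq_gt0. Qed.

Lemma mu_1 : mu_ beta 1 = 1.
Proof. exact: cseq1. Qed.

Lemma muS n : (0 < n)%N -> mu_ beta n.+1 = mu_ beta n * ((n%:R + beta) / n%:R).
Proof. by move=> n0; exact: cseqS. Qed.

Lemma growthE n (x : R) : growth beta x n = cseq n x / mu_ beta n.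
Proof. by []. Qed.

Local Opaque mu_ cseq growth.

Let g := p * (beta + 1).
Let beta1_gt0 : 0 < beta + 1. Proof. by rewrite -ltrBlDr sub0r. Qed.
Let g_gt0 : 0 < g. Proof. exact: mulr_gt0. Qed.
Let g_gtN1 : -1 < g. Proof. by rewrite (lt_trans _ g_gt0)// ltrN10. Qed.

(** The conditional expectation of step [n.+1] given the past is [gain n] times
    the weighted sum [Sigma_ n]. *)
Definition gain (n : nat) : R := p * (beta + 1) / (n%:R * mu_ beta n.+1).

Lemma gain_mu n : (0 < n)%N -> gain n * mu_ beta n.+1 = g / n%:R.
Proof.
move=> n0; have : mu_ beta n.+1 != 0 by rewrite gt_eqF// mu_gt0.
rewrite /gain -/g; move: (mu_ _ _) (n%:R : R) => m x m0.
by rewrite invfM mulrA mulfVK.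
Qed.

Local Notation S n := (Sigma_ beta step n).

Lemma Sigma_S (Y : nat -> T -> R) n w :
  Sigma_ beta Y n.+1 w = Sigma_ beta Y n w + Y n.+1 w * mu_ beta n.+1.
Proof. by rewrite /Sigma_ big_nat_recr. Qed.

Lemma walkS (Y : nat -> T -> R) n w : walk Y n.+1 w = walk Y n w + Y n.+1 w.
Proof. by rewrite /walk big_nat_recr. Qed.

Lemma Sigma_1 w : S 1 w = 1.
Proof. by rewrite /Sigma_ big_nat1 step_1 mul1r mu_1. Qed.

Lemma walk_1 w : walk step 1 w = 1.
Proof. by rewrite /walk big_nat1. Qed.

Let bS n : bdd_meas (S n).
Proof.
by apply: bdd_meas_sum => k; apply: bdd_measM => //; exact: bdd_meas_cst.
Qed.

Lemma repeat_probE n i : (0 < n)%N -> (0 < i <= n)%N ->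
  repeat_prob n.+1 i = gain n * mu_ beta i.
Proof.
move=> n0 hi; rewrite /repeat_prob (recall_pmf HX n0 hi) /= /gain.
move: (mu_ beta i) (mu_ beta n.+1) (n%:R : R) => x y z.
by rewrite invfM; ring.
Qed.

(** Summing over the recalled time [i], the law of the recalled time is exactly
    proportional to the weight of [step i] in [Sigma_]. *)
Lemma mean_step_mul m j : (0 < j <= m)%N ->
  mean P (fun w => step j w * step m.+1 w) =
  gain m * mean P (fun w => step j w * S m w).
Proof.
move=> jm; have /andP[j0 jm'] := jm; have m0 := leq_trans j0 jm'.
rewrite (_ : (fun w => step j w * step m.+1 w) =
    fun w => \sum_(i <- index_iota 1 m.+1)
      step j w * step i w * repeat_pattern (fun=> i) [:: m.+1] w); last first.
  apply/funext => w; rewrite stepS_sum// mulr_sumr; apply: eq_bigr => i _.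
  by rewrite /repeat_pattern big_seq1; ring.
rewrite mean_sum; last by move=> i; apply: bdd_measM.
rewrite (_ : (fun w => step j w * S m w) =
    fun w => \sum_(i <- index_iota 1 m.+1) mu_ beta i * (step j w * step i w));
  last first.
  by apply/funext => w; rewrite mulr_sumr; apply: eq_bigr => i _; ring.
rewrite mean_sum; last by move=> i; apply: bdd_measZ.
rewrite mulr_sumr big_nat_cond [RHS]big_nat_cond.
apply: eq_bigr => i /andP[/andP[i0 im] _].
rewrite (@past_future_indep m)// ?i0//; last first.
  by move=> l; rewrite inE => /eqP ->.
rewrite mean_repeat_pattern//; last by move=> l; rewrite inE => /eqP ->.
by rewrite big_seq1 repeat_probE ?i0// meanZ//; ring.
Qed.

(** Test functions for which the innovation [step m.+1 - gain m * Sigma_ m] has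
    vanishing correlation at every time [m >= n].  The class is closed
    under linear combinations by construction, and the sums studied below are linear
    in the steps. *)
Definition past_test (n : nat) (G : T -> R) : Prop :=
  bdd_meas G /\ forall m, (n <= m)%N ->
    mean P (fun w => G w * step m.+1 w) = gain m * mean P (fun w => G w * S m w).

Lemma past_test_step n j : (0 < j <= n)%N -> past_test n (step j).
Proof.
move=> /andP[j0 jn]; split => // m nm.
by apply: mean_step_mul; rewrite j0 (leq_trans jn).
Qed.

Lemma past_testD n F G : past_test n F -> past_test n G ->
  past_test n (fun w => F w + G w).
Proof.
move=> [bF hF] [bG hG]; split=> [|m nm]; first exact: bdd_measD.
under eq_fun do rewrite mulrDl; rewrite meanD; [|exact: bdd_measM..].
rewrite hF// hG// -mulrDr -meanD; [|exact: bdd_measM..].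
by congr (_ * mean _ _); apply/funext => w; rewrite mulrDl.
Qed.

Lemma past_testZ n c F : past_test n F -> past_test n (fun w => c * F w).
Proof.
move=> [bF hF]; split=> [|m nm]; first exact: bdd_measZ.
under eq_fun do rewrite -mulrA; rewrite meanZ; last exact: bdd_measM.
rewrite hF// mulrCA -(meanZ P c); last exact: bdd_measM.
by congr (_ * mean _ _); apply/funext => w; rewrite mulrA.
Qed.

Lemma past_testW n m F : (n <= m)%N -> past_test n F -> past_test m F.
Proof. by move=> nm [bF hF]; split => // k mk; apply: hF; exact: leq_trans mk. Qed.

Lemma past_test_Sigma n : past_test n.+1 (S n.+1).
Proof.
elim: n => [|n IH].
  rewrite (_ : S 1 = step 1); first exact: past_test_step.
  by apply/funext => w; rewrite Sigma_1 step_1.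
rewrite (_ : S n.+2 = fun w => S n.+1 w + mu_ beta n.+2 * step n.+2 w).
  apply: past_testD; first exact: past_testW IH.
  by apply: past_testZ; apply: past_test_step; rewrite leqnn.
by apply/funext => w; rewrite Sigma_S mulrC.
Qed.

Lemma mean_stepS n : (0 < n)%N -> mean P (step n.+1) = gain n * mean P (S n).
Proof.
move=> n0; have [_ /(_ n n0)] := @past_test_step 1 1 isT.
have E (F : T -> R) : (fun w => step 1 w * F w) = F.
  by apply/funext => w; rewrite step_1 mul1r.
by rewrite !E.
Qed.

(** Martingale property of [M_], integrated: [Sigma_] has mean [cseq n g]. *)
Lemma mean_Sigma n : (0 < n)%N -> mean P (S n) = cseq n g.
Proof.
case: n => // n _; elim: n => [|n IH].
  rewrite (_ : S 1 = fun=> 1) ?mean_cst ?cseq1//.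
  by apply/funext => w; rewrite Sigma_1.
have -> : mean P (S n.+2) =
    mean P (S n.+1) + mu_ beta n.+2 * (gain n.+1 * mean P (S n.+1)).
  rewrite -mean_stepS// -meanZ// -meanD//; last exact: bdd_measZ.
  by congr (mean _ _); apply/funext => w; rewrite Sigma_S mulrC.
have gm := @gain_mu n.+1 isT.
rewrite IH (@cseqS _ n.+1 g)//.
have n1 : n.+1%:R != 0 :> R by rewrite pnatr_eq0.
move: (mu_ _ _) (gain _) (cseq _ _) (n.+1%:R : R) gm n1 => x y z t xy t0.
by rewrite [x * (y * z)]mulrA [x * y]mulrC xy; field.
Qed.

Lemma mean_stepE n : (0 < n)%N -> mean P (step n.+1) = gain n * cseq n g.
Proof. by move=> n0; rewrite mean_stepS// mean_Sigma. Qed.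

Lemma mean_Sigma_sqr n : (0 < n)%N ->
  mean P (fun w => S n.+1 w * S n.+1 w) =
  mean P (fun w => S n w * S n w) * (1 + 2 * (g / n%:R)) +
  mu_ beta n.+1 * (g / n%:R) * cseq n g.
Proof.
move=> n0; rewrite (_ : (fun w => S n.+1 w * S n.+1 w) = fun w =>
    S n w * S n w + (2 * mu_ beta n.+1 * (S n w * step n.+1 w) +
    mu_ beta n.+1 ^+ 2 * step n.+1 w)); last first.
  by apply/funext => w; rewrite Sigma_S -[in X in _ + (_ + X)](step_idem _ _ n.+1 w); ring.
have bSS : bdd_meas (fun w => S n w * S n w) by exact: bdd_measM.
have bSs : bdd_meas (fun w => S n w * step n.+1 w) by exact: bdd_measM.
rewrite meanD//; last by apply: bdd_measD; exact: bdd_measZ.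
rewrite meanD; [|exact: bdd_measZ..].
rewrite !meanZ// mean_stepE//.
case: n n0 bSS bSs => // n _ _ _.
have [_ /(_ n.+1 (leqnn _)) ->] := past_test_Sigma n.
have := @gain_mu n.+1 isT; move=> <-.
by move: (mu_ _ _) (gain _) (cseq _ _) => x y z; ring.
Qed.

(** Predictable part of the Doob decomposition: [gain k * Sigma_ k] is the
    conditional expectation of step [k.+1]. *)
Definition compensator (Y : nat -> T -> R) (n : nat) (w : T) : R :=
  \sum_(1 <= k < n) gain k * Sigma_ beta Y k w.

Definition centred_walk (n : nat) (w : T) : R :=
  walk step n w - compensator step n w.

Lemma centred_walk1 w : centred_walk 1 w = 1.
Proof. by rewrite /centred_walk /compensator walk_1 big_geq ?subr0. Qed.

Lemma centred_walkS n w : (0 < n)%N -> centred_walk n.+1 w =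
  centred_walk n w + (step n.+1 w - gain n * S n w).
Proof.
move=> n0; rewrite /centred_walk /compensator walkS big_nat_recr//=; ring.
Qed.

Lemma past_test_centred_walk n : past_test n.+1 (centred_walk n.+1).
Proof.
elim: n => [|n IH].
  rewrite (_ : centred_walk 1 = step 1); first exact: past_test_step.
  by apply/funext => w; rewrite centred_walk1 step_1.
rewrite (_ : centred_walk n.+2 = fun w => centred_walk n.+1 w +
   (step n.+2 w + (- gain n.+1) * S n.+1 w)).
  apply: past_testD; first exact: past_testW IH.
  apply: past_testD; first by apply: past_test_step; rewrite leqnn.
  by apply: past_testZ; apply: past_testW (past_test_Sigma n).
by apply/funext => w; rewrite centred_walkS// mulNr.
Qed.

(** Increments of the centred walk are orthogonal to its past, and each has second
    moment at most the mean of the corresponding step, since [step ^ 2 = step]. *)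
Lemma mean_centred_walk_sqr n : (0 < n)%N ->
  mean P (fun w => centred_walk n w * centred_walk n w) <= mean P (walk step n).
Proof.
have bwalk m : bdd_meas (walk step m) by exact: bdd_meas_sum.
case: n => // n _; elim: n => [|n IH].
  rewrite (_ : (fun w => _) = walk step 1)//.
  by apply/funext => w; rewrite centred_walk1 walk_1 mulr1.
have [bD hD] := past_test_centred_walk n.
have [_ hS] := past_test_Sigma n.
have bSs : bdd_meas (fun w => S n.+1 w * step n.+2 w) by exact: bdd_measM.
have bSS : bdd_meas (fun w => S n.+1 w * S n.+1 w) by exact: bdd_measM.
have bDs : bdd_meas (fun w => centred_walk n.+1 w * step n.+2 w) by exact: bdd_measM.
have bDS : bdd_meas (fun w => centred_walk n.+1 w * S n.+1 w) by exact: bdd_measM.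
have bDD : bdd_meas (fun w => centred_walk n.+1 w * centred_walk n.+1 w).
  exact: bdd_measM.
rewrite (_ : (fun w => centred_walk n.+2 w * _) = fun w =>
    centred_walk n.+1 w * centred_walk n.+1 w +
    (2 * (centred_walk n.+1 w * step n.+2 w) +
    ((- 2 * gain n.+1) * (centred_walk n.+1 w * S n.+1 w) +
    (step n.+2 w + ((- 2 * gain n.+1) * (S n.+1 w * step n.+2 w) +
    gain n.+1 ^+ 2 * (S n.+1 w * S n.+1 w)))))); last first.
  apply/funext => w; rewrite centred_walkS//.
  by rewrite -[in X in _ + (_ + (_ + (X + _)))](step_idem _ _ n.+2 w); ring.
rewrite !meanD//; try (by do ?[apply: bdd_measD|apply: bdd_measZ]).
rewrite !meanZ// hD// hS//.
rewrite (_ : walk step n.+2 = fun w => walk step n.+1 w + step n.+2 w); last first.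
  by apply/funext => w; rewrite walkS.
rewrite meanD//.
have SS0 : 0 <= mean P (fun w => S n.+1 w * S n.+1 w).
  by apply: mean_ge0 => w; rewrite -expr2 sqr_ge0.
have gSS : 0 <= gain n.+1 ^+ 2 * mean P (fun w => S n.+1 w * S n.+1 w).
  by rewrite mulr_ge0 ?sqr_ge0.
move: IH gSS; rewrite expr2.
move: (mean _ _) (mean _ _) (mean _ _) (mean _ _) (mean _ _) (gain _).
by move=> a b c k e f h1 h2; lra.
Qed.

(** * Second moment bound for the martingale *)

Hypothesis beta_lt_g : beta < g.

Let g_lt : g < beta + 1.
Proof. by rewrite /g -[ltRHS]mul1r ltr_pM2r. Qed.

Let dl_gt0 : 0 < g - beta. Proof. by rewrite subr_gt0. Qed.

Let K := g / (g - beta).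
Let K_ge0 : 0 <= K. Proof. by rewrite divr_ge0 ?ltW. Qed.

Local Notation s := (growth beta g).

Let natDbeta_gt0 n : (0 < n)%N -> 0 < n%:R + beta.
Proof.
move=> n0; have nR : 1 <= n%:R :> R by rewrite ler1n.
by move: beta_gtN1; lra.
Qed.

Lemma mu_le_cseq n : (0 < n)%N -> mu_ beta n <= cseq n g.
Proof.
move=> n0; have := growth_ge1 beta_gtN1 beta_lt_g n0.
rewrite growthE; have := mu_gt0 n0; move: (mu_ beta n) (cseq n g) => m c m0.
by rewrite ler_pdivlMr// mul1r.
Qed.

(** The algebra of one step of the recursion below, with [a], [m], [c] for the
    second moment of [Sigma_], [mu_] and [cseq], [x] for the time, [h] for [g]
    and [b] for [beta]. *)
Let sqr_bound_step (a m c x k h b : R) : a <= (1 + k) * c ^+ 2 - k * m * c ->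
  0 < c -> 0 < m -> m <= c -> 0 < x -> k * (h - b) = h -> 0 <= k -> 0 < h -> b < h ->
  a * (1 + 2 * (h / x)) + m * ((x + b) / x) * (h / x) * c <=
  (1 + k) * (c * ((x + h) / x)) ^+ 2 -
  k * (m * ((x + b) / x)) * (c * ((x + h) / x)).
Proof.
move=> IH c0 m0 mc x0 KE k0 h0 bh; rewrite -subr_ge0.
have hmb : 0 <= h * c - b * m.
  rewrite subr_ge0; have [b0|/ltW b0] := leP b 0.
    apply: (@le_trans _ _ 0); last by rewrite mulr_ge0 ?ltW.
    by rewrite mulr_le0_ge0// ltW.
  by apply: ler_pM => //; exact: ltW.
have -> : (1 + k) * (c * ((x + h) / x)) ^+ 2 -
    k * (m * ((x + b) / x)) * (c * ((x + h) / x)) -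
    (a * (1 + 2 * (h / x)) + m * ((x + b) / x) * (h / x) * c) =
    ((1 + k) * c ^+ 2 - k * m * c - a) * (1 + 2 * (h / x)) +
    (1 + k) * h * c * (h * c - b * m) / x ^+ 2 +
    (k * (h - b) - h) * (m * c / x).
  by field; rewrite gt_eqF.
rewrite KE subrr mul0r addr0 addr_ge0//.
  by rewrite mulr_ge0 ?subr_ge0// addr_ge0// mulr_ge0// divr_ge0// ltW.
by rewrite divr_ge0 ?exprn_ge0 ?(ltW x0)// !mulr_ge0// ?addr_ge0// ltW.
Qed.

(** With [K = g / (g - beta)] the bound is preserved by the recursion: the
    discrepancy is [(1 + K) * g * c * (g * c - beta * mu) / n ^+ 2]. *)
Lemma mean_Sigma_sqr_le n : (0 < n)%N ->
  mean P (fun w => S n w * S n w) <=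
  (1 + K) * cseq n g ^+ 2 - K * mu_ beta n * cseq n g.
Proof.
case: n => // n _; elim: n => [|n IH].
  rewrite (_ : (fun w => S 1 w * S 1 w) = fun=> 1); last first.
    by apply/funext => w; rewrite Sigma_1 mulr1.
  by rewrite mean_cst cseq1// mu_1; lra.
rewrite (@mean_Sigma_sqr n.+1 isT) (@muS n.+1 isT) (@cseqS _ n.+1 g isT g_gtN1).
apply: sqr_bound_step => //.
- exact: cseq_gt0.
- exact: mu_gt0.
- exact: mu_le_cseq.
- by rewrite /K mulfVK// gt_eqF.
Qed.

(** * The martingale and the compensated walk *)

Local Notation M n := (M_ p beta step n).

Lemma cseq_g_gt0 n : (0 < n)%N -> 0 < cseq n g.
Proof. by move=> n0; exact: cseq_gt0. Qed.

Let M_E n : M n = fun w => (cseq n g)^-1 * S n w.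
Proof. by apply/funext => w; rewrite /M_ mulrC. Qed.

Let bM n : bdd_meas (M n).
Proof. by rewrite M_E; exact: bdd_measZ. Qed.

Lemma mean_M n : (0 < n)%N -> mean P (M n) = 1.
Proof.
move=> n0; rewrite M_E meanZ// mean_Sigma// mulVf// gt_eqF//.
exact: cseq_g_gt0.
Qed.

Lemma mean_M_sqr_le n : (0 < n)%N -> mean P (fun w => M n w * M n w) <= 1 + K.
Proof.
move=> n0; rewrite M_E.
rewrite (_ : (fun w => _) =
    fun w => (cseq n g)^-1 ^+ 2 * (S n w * S n w)); last first.
  by apply/funext => w; rewrite mulrACA expr2.
rewrite meanZ; last exact: bdd_measM.
have := mean_Sigma_sqr_le n0; have := cseq_g_gt0 n0; have := mu_gt0 n0.
move: (mean _ _) (mu_ beta n) (cseq n g) => a m c m0 c0 am.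
rewrite exprVn mulrC ler_pdivrMr ?exprn_gt0//; apply: (le_trans am).
rewrite gerBl; apply: mulr_ge0; last exact: ltW.
by apply: mulr_ge0; [exact: K_ge0|exact: ltW].
Qed.

(** Paley--Zygmund: [M n] has mean 1 and bounded second moment, so it cannot be
    small with probability close to 1. *)
Lemma prob_M_large n : (0 < n)%N ->
  (4 * (1 + K))^-1 <= fine (P [set w | 2^-1 < M n w]).
Proof.
move=> n0; set A := [set w | _].
have mA : measurable A.
  rewrite (_ : A = M n @^-1` `]2^-1, +oo[%classic).
    by rewrite -[X in measurable X]setTI; apply: (bM n).1.
  by apply/seteqP; split => w /=; rewrite in_itv/= andbT.
have K1 : 0 < 1 + K by rewrite ltr_wpDr.
(* Pointwise, [M <= 1/2] off [A], and [M <= M ^ 2 / (4 k) + k] on [A] for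
   [k = 1 + K], by the arithmetic-geometric mean inequality. *)
have bA := @bdd_meas_indic _ _ R _ mA.
have h : mean P (M n) <= mean P (fun w => 2^-1 +
    ((4 * (1 + K))^-1 * (M n w * M n w) + (1 + K) * \1_A w)).
  apply: mean_le => //.
    apply: bdd_measD; first exact: bdd_meas_cst.
    by apply: bdd_measD; apply: bdd_measZ => //; exact: bdd_measM.
  move=> w; rewrite indicE.
  have [wA|wA] := boolP (w \in A).
    rewrite mulr1 -subr_ge0.
    rewrite (_ : _ - _ = 2^-1 + (4 * (1 + K))^-1 * (M n w - 2 * (1 + K)) ^+ 2).
      by rewrite addr_ge0 ?invr_ge0// mulr_ge0 ?sqr_ge0// invr_ge0 mulr_ge0// ltW.
    by move: (M n w) (K1); move: (1 + K) => x y x0; field; rewrite gt_eqF.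
  rewrite mulr0 addr0; apply: (@le_trans _ _ 2^-1).
    by rewrite leNgt; apply/negP => hw; move/negP: wA; apply; rewrite inE.
  rewrite lerDl; apply: mulr_ge0; last by rewrite -expr2 sqr_ge0.
  by rewrite invr_ge0 mulr_ge0// ltW.
have bMM : bdd_meas (fun w => M n w * M n w) by exact: bdd_measM.
move: h; rewrite meanD; [|exact: bdd_meas_cst|]; last first.
  by apply: bdd_measD; exact: bdd_measZ.
rewrite mean_cst meanD; [|exact: bdd_measZ..].
rewrite !meanZ// mean_M// mean_indic//.
have := mean_M_sqr_le n0; move: (fine _) (mean _ _) K1; move: (1 + K) => k x y k0.
move=> yk h.
have yk4 : (4 * k)^-1 * y <= 4^-1.
  by rewrite invfM -mulrA ler_piMr// mulrC ler_pdivrMr// mul1r.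
have kx : 4^-1 <= k * x by lra.
by rewrite invfM ler_pdivrMr// mulrC.
Qed.

(** The mean of step [n.+1] is an increment of [K * growth]: this is what makes the
    compensator a weighted mean for the weights [growth n.+1 - growth n]. *)
Lemma gain_growth n : (0 < n)%N -> gain n * cseq n g = K * (s n.+1 - s n).
Proof.
move=> n0; rewrite growth_increment// growthE /gain -/g muS// /K.
have m0 := mu_gt0 n0; have nb := natDbeta_gt0 n0; have dl := dl_gt0.
have x0 : 0 < n%:R :> R by rewrite ltr0n.
move: (mu_ beta n) (cseq n g) (n%:R : R) m0 nb x0 => m c x m0 nb x0.
by field; rewrite !gt_eqF.
Qed.

Lemma mean_walk n : (0 < n)%N -> mean P (walk step n) = 1 + K * (s n - 1).
Proof.
have bwalk m : bdd_meas (walk step m) by exact: bdd_meas_sum.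
case: n => // n _; elim: n => [|n IH].
  rewrite (_ : walk step 1 = fun=> 1); last by apply/funext => w; rewrite walk_1.
  by rewrite mean_cst growth1// subrr mulr0 addr0.
rewrite (_ : walk step n.+2 = fun w => walk step n.+1 w + step n.+2 w); last first.
  by apply/funext => w; rewrite walkS.
rewrite (meanD P (bwalk n.+1) (bstep n.+2)) IH.
rewrite (@mean_stepE n.+1 isT) (@gain_growth n.+1 isT).
by move: (s n.+1) (s n.+2) => x y; ring.
Qed.

Lemma mean_centred_walk_le n : (0 < n)%N ->
  mean P (fun w => centred_walk n w * centred_walk n w) <= (1 + K) * s n.
Proof.
move=> n0; apply: (le_trans (mean_centred_walk_sqr n0)); rewrite mean_walk//.
have s1 := growth_ge1 beta_gtN1 beta_lt_g n0.
move: (s n) s1 K K_ge0 => x x1 k k0.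
rewrite -subr_ge0 (_ : _ - _ = (x - 1) + k); last by ring.
by rewrite addr_ge0// subr_ge0.
Qed.

Lemma compensatorE (Y : nat -> T -> R) n w : compensator Y n w =
  K * \sum_(1 <= k < n) (s k.+1 - s k) * M_ p beta Y k w.
Proof.
rewrite /compensator mulr_sumr big_nat_cond [RHS]big_nat_cond.
apply: eq_bigr => k /andP[/andP[k0 _] _].
rewrite mulrA -gain_growth// /M_ -/g; have := cseq_g_gt0 k0.
move: (cseq k g) (Sigma_ _ _ _ _) => c x c0.
by rewrite -mulrA [c * _]mulrC mulfVK// gt_eqF.
Qed.

(** The centred walk is negligible with respect to [growth] along a sparse
    subsequence of times, by its second moment bound. *)
Lemma centred_walk_negligible : exists q : nat, (0 < q)%N /\
  {ae P, forall w, centred_walk (j.+1 ^ q)%N w / s (j.+1 ^ q)%N @[j --> \oo]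
     --> (0 : R)}.
Proof.
have [q [q0 [c c0 [N _ HN]]]] := growth_power_ge beta_gtN1 beta_lt_g g_lt.
exists q; split => //.
pose nu j := (j.+1 ^ q)%N.
have nu0 j : (0 < nu j)%N by rewrite expn_gt0.
have sg0 j : 0 < s (nu j) by apply: growth_gt0.
have bD j : bdd_meas (centred_walk (nu j)).
  by case: (nu j) (nu0 j) => // m _; have [] := past_test_centred_walk m.
pose Z j w := (s (nu (j + N)%N))^-1 ^+ 2 *
  (centred_walk (nu (j + N)%N) w * centred_walk (nu (j + N)%N) w).
have bDD j : bdd_meas (fun w => centred_walk (nu j) w * centred_walk (nu j) w).
  exact: bdd_measM.
have := @cvg0_of_mean_summable _ T R P Z ((1 + K) / c).
have bZ j : bdd_meas (Z j) by exact: bdd_measZ.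
have Z0 j w : 0 <= Z j w.
  by rewrite mulr_ge0 ?sqr_ge0// -expr2 sqr_ge0.
(* The shift by [N] moves to the times where [growth (j.+1 ^ q)] is at least
   [c * j.+1 ^ 2]. *)
have Zc j : mean P (Z j) <= (1 + K) / c / j.+1%:R ^+ 2.
  rewrite /Z meanZ//; set i := (j + N)%N.
  have hm := mean_centred_walk_le (nu0 i).
  have si : c * j.+1%:R ^+ 2 <= s (nu i).
    apply: le_trans (HN i (leq_addl _ _)).
    rewrite ler_wpM2l ?(ltW c0)// lerXn2r ?nnegrE// ler_nat ltnS.
    exact: leq_addr.
  have K1 : 0 <= 1 + K by rewrite addr_ge0.
  have j0 : 0 < j.+1%:R ^+ 2 :> R by rewrite exprn_gt0.
  have := sg0 i; move: hm si K1 j0; move: (mean _ _) (s _) (1 + K) (_ ^+ 2).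
  move=> x y k z xy czy k0 z0 y0.
  apply: (@le_trans _ _ (k / y)).
    rewrite exprVn mulrC ler_pdivrMr ?exprn_gt0//.
    by rewrite expr2 mulrA mulfVK ?gt_eqF.
  rewrite -mulrA -invfM ler_wpM2l// lef_pV2 ?posrE// ?mulr_gt0//.
move=> /(_ bZ Z0 Zc); apply: filterS => w Zw.
pose u j := centred_walk (nu j) w / s (nu j).
change (u n @[n --> \oo] --> (0 : R)).
rewrite -(cvg_shiftn N).
apply/cvgrPdist_le => e e0.
have e2 : 0 < e ^+ 2 by rewrite exprn_gt0.
move/cvgrPdist_le : Zw => /(_ _ e2); apply: filterS => j.
rewrite !sub0r !normrN (ger0_norm (Z0 _ _)) /Z -expr2 -exprMn mulrC /= -/(u _).
by rewrite -[X in X <= _ -> _]real_normK ?num_real// ler_sqr ?nnegrE ?(ltW e0).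
Qed.

Lemma walk_leS n w : walk step n w <= walk step n.+1 w.
Proof. by rewrite walkS lerDl step_ge0. Qed.

(** The compensator divided by [growth] is a weighted mean of the values of [M],
    so it has the limit [K * l] wherever [M] tends to [l]. *)
Lemma walk_growth_cvg : {ae P, forall w, forall l : R,
  M n w @[n --> \oo] --> l -> walk step n w / s n @[n --> \oo] --> K * l}.
Proof.
have [q [q0 +]] := centred_walk_negligible.
apply: filterS => w Dw l Ml.
have q_inf j : (j < j.+1 ^ q)%N by rewrite -[X in (X <= _)%N]expn1 leq_pexp2l.
exact: (@cvg_of_compensator R (fun n => walk step n w)
  (fun n => compensator step n w) s (fun n => M n w) (fun j => (j.+1 ^ q)%N) K l
  (fun n => sumr_ge0 _ (fun k _ => step_ge0 _ _ k w))
  (fun n => walk_leS n w)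
  (fun n => growth_gt0 beta_gtN1 beta_lt_g (n := n))
  (fun n => growth_leS beta_gtN1 beta_lt_g (n := n))
  (cvg_growth_pinfty beta_gtN1 beta_lt_g g_lt)
  q_inf (cvg_growth_power_ratio beta_gtN1 beta_lt_g g_lt q0)
  (fun n => compensatorE step n w) Dw Ml).
Qed.

(** * Positivity of the limit and asymptotics of the walk *)

Lemma ae_notin_null (A : set T) : measurable A -> P A = 0%E ->
  {ae P, forall w, ~ A w}.
Proof. by move=> mA PA0; exists A; split => // w /= /contrapT. Qed.

(** Almost surely every recalled time lies in the past, and the two recursions then
    agree by strong induction. *)
Lemma X_eq_step_ae : {ae P, forall w, forall n, (0 < n)%N -> X n w = step n w}.
Proof.
have recall_ae : {ae P, forall w, forall n k, (0 < n)%N -> ~~ (0 < k <= n)%N ->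
    recall n.+1 w <> k}.
  apply/ae_foralln => n; apply/ae_foralln => k.
  have [n0|n0] := ltnP 0 n; last by apply: aeW.
  have [kn|kn] := boolP (0 < k <= n)%N; first by apply: aeW.
  have mk : measurable (recall n.+1 @^-1` [set k]) by exact: measurable_funPTI.
  have := ae_notin_null mk (recall_pmf0 HX n0 kn).
  by apply: filterS => w rk _ _.
have step_ae : {ae P, forall w, forall n, (0 < n)%N ->
    X n.+1 w = (alpha n.+1 w)%:R * X (recall n.+1 w) w}.
  apply/ae_foralln => n; have [n0|n0] := ltnP 0 n; last by apply: aeW.
  by have := stepS HX n0; apply: filterS => w ->.
apply: filterS2 recall_ae step_ae => w rw xw n.
have [m] := ubnP n; elim: m n => // m IH [//|[|n]] nm _.
  by rewrite (step1 HX) step_1.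
rewrite xw// step_recall//; congr (_ * _).
have rk : (0 < recall n.+2 w <= n.+1)%N.
  by apply/negPn/negP => h; exact: rw h erefl.
have /andP[r0 rn] := rk; rewrite ltnS rn IH//.
by rewrite ltnS in nm; apply: leq_ltn_trans nm.
Qed.

(** If [Minf] vanished almost surely, dominated convergence would make the
    probability that [M n] exceeds 1/2 tend to zero. *)
Lemma prob_limit_gt0 (Minf : {RV P >-> R}) : as_limit P (M_ p beta step) Minf ->
  (0 < P [set w | (0 < Minf w)%R])%E.
Proof.
move=> hM; set B := [set w | 0 < Minf w].
have mB : measurable B.
  rewrite (_ : B = Minf @^-1` `]0, +oo[%classic); first exact: measurable_funPTI.
  by apply/seteqP; split => w /=; rewrite in_itv/= andbT.
rewrite lt_neqAle measure_ge0 andbT eq_sym; apply/eqP => PB0.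
pose A n := [set w | 2^-1 < M n w].
have mA n : measurable (A n).
  rewrite (_ : A n = M n @^-1` `]2^-1, +oo[%classic).
    by rewrite -[X in measurable X]setTI; apply: (bM n).1.
  by apply/seteqP; split => w /=; rewrite in_itv/= andbT.
have cvgA : {ae P, forall w, setT w ->
    (fun n => (\1_(A n) w)%:E) @ \oo --> (0%:E : \bar R)}.
  apply: filterS2 hM (ae_notin_null mB PB0) => w Mw Bw _.
  apply: cvg_near_cst; have : Minf w < 2^-1.
    by apply: (@le_lt_trans _ _ 0) => //; rewrite leNgt; exact/negP.
  move=> /(cvgr_lt _ Mw); apply: filterS => n /= Mn.
  by rewrite indicE memNset// /A /= => h; have := lt_trans h Mn; rewrite ltxx.
have [] := @dominated_convergence _ T R P setT measurableT
    (fun n w => (\1_(A n) w)%:E) (cst 0%E) (EFin \o cst 1).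
- by move=> n; apply/measurable_EFinP; exact: measurable_indic.
- exact: measurable_cst.
- exact: cvgA.
- by apply: bdd_meas_integrable; exact: bdd_meas_cst.
- by apply: aeW => w n _; rewrite indicE gee0_abs lee_fin//; case: (_ \in _).
move=> _ _; rewrite integral0 => h.
have K1 : 0 < (4 * (1 + K))^-1 by rewrite invr_gt0 mulr_gt0// ltr_wpDr.
have : ((4 * (1 + K))^-1%:E <= 0 :> \bar R)%E.
  rewrite -(cvg_lim _ h)//; apply: lime_ge; first by apply/cvg_ex; exists 0%E.
  near=> n; rewrite /= integral_indic// setIT.
  have n0 : (0 < n)%N by near: n; exact: nbhs_infty_gt.
  have PA : P (A n) \is a fin_num by exact: fin_num_measure.
  apply: (@le_trans _ _ (fine (P (A n)))%:E).
    by rewrite lee_fin; exact: prob_M_large.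
  by rewrite (fineK PA).
by rewrite lee_fin leNgt K1.
Unshelve. all: by end_near. Qed.

(** [growth n] is asymptotic to [Gamma (beta + 1) / Gamma (g + 1) * n `^ (g - beta)],
    and [Gamma (g + 1) = g * Gamma g] turns the limit [K * l] of the rescaled walk
    into the announced constant. *)
Lemma walk_asymp w (l : R) : 0 < l -> walk step n w / s n @[n --> \oo] --> K * l ->
  asymp_equiv (fun n => walk step n w)
    (fun n => Cconst p beta * l * n%:R `^ (g - beta)).
Proof.
move=> l0 wl.
have b1 : -1 < beta by exact: beta_gtN1.
have bg : beta <= g <= beta + 1 by rewrite !ltW.
have sg := cvg_growth b1 bg.
have Gb : 0 < Gamma (beta + 1) by exact: Gamma_gt0.
have Gg : 0 < Gamma g by exact: Gamma_gt0.
have CE : Cconst p beta * l = K * l * (Gamma (beta + 1) / Gamma (g + 1)).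
  rewrite (GammaS g_gt0) /Cconst -/g /K.
  have := dl_gt0; move: Gb Gg g_gt0.
  move: (Gamma (beta + 1)) (Gamma g) (g - beta) => u v x u0 v0 gp x0.
  by field; rewrite !gt_eqF.
have C0 : Cconst p beta * l != 0.
  rewrite CE (GammaS g_gt0).
  by rewrite gt_eqF// mulr_gt0// ?divr_gt0 ?mulr_gt0 ?invr_gt0.
have h : walk step n w / s n * (s n / n%:R `^ (g - beta)) / (Cconst p beta * l)
    @[n --> \oo] --> (1 : R).
  rewrite -[X in _ --> X](mulfV C0); apply: cvgM; last exact: cvg_cst.
  by rewrite CE; apply: cvgM.
apply: cvg_trans h; apply: near_eq_cvg; near=> n.
have n0 : (0 < n)%N by near: n; exact: nbhs_infty_gt.
have sn : s n != 0 by rewrite gt_eqF// growth_gt0.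
move: sn; move: (s n) (walk _ _ _) (_ `^ _) (Cconst p beta * l) => x y z t x0.
by rewrite mulrA mulfVK// invfM mulrA mulrAC.
Unshelve. all: by end_near. Qed.

End elephant.

Unset Implicit Arguments.
Set Strict Implicit.
Set Printing Implicit Defensive.

Theorem theorem2p3 (R : realType) (d : measure_display) (T : measurableType d)
    (P : probability T R) (p beta : R)
    (hp0 : 0 < p) (hp1 : p < 1) (hb1 : -1 < beta) (hbp : beta < p / (1 - p))
    (alpha : nat -> {RV P >-> bool}) (recall : nat -> {RV P >-> nat})
    (X : nat -> {RV P >-> R}) (hX : laziest_erw p beta alpha recall X)
    (Minf : {RV P >-> R})
    (hM : as_limit P (M_ p beta (fun n => X n)) Minf) :
  (0 < P [set w | 0 < Minf w]%R)%E /\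
  {ae P, forall w, 0 < Minf w ->
    asymp_equiv (fun n => walk (fun n => X n) n w)
      (fun n => Cconst p beta * Minf w * n%:R `^ (p * (beta + 1) - beta))}.
Proof.
(* [beta * (1 - p) < p] is the positivity of [p * (beta + 1) - beta]. *)
have beta_lt : beta < p * (beta + 1).
  by move: hbp; rewrite ltr_pdivlMr ?subr_gt0//; lra.
have XY := X_eq_step_ae hX.
have hMY : as_limit P (M_ p beta (step alpha recall)) Minf.
  apply: filterS2 hM XY => w Mw XYw; apply: cvg_trans Mw.
  apply: near_eq_cvg; apply: nearW => n; rewrite /M_; congr (_ / _).
  apply: eq_big_nat => k /andP[k0 _]; by rewrite XYw.
split; first exact: (prob_limit_gt0 hp0 hp1 hb1 hX beta_lt hMY).
have walkY := walk_growth_cvg hp0 hp1 hb1 hX beta_lt.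
apply: filterS3 XY hMY walkY => w XYw Mw wl M0.
have -> : (fun n => walk (fun n => X n) n w) =
          fun n => walk (step alpha recall) n w.
  apply/funext => n; apply: eq_big_nat => k /andP[k0 _]; exact: XYw.
exact: (walk_asymp hp0 hp1 hb1 beta_lt M0 (wl _ Mw)).
Qed.
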